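(* Let $(z_h^{rt},\overline u_h,\mu_h,\lambda_h^+,\lambda_h^-)\in\mathcal{R}T^0(\mathcal{T}_h)\times\mathcal{L}^0(\mathcal{T}_h)\times\mathbb{R}\times(\mathcal{L}^0(\mathcal{S}_h^I))^2$ satisfy $z_h^{rt}\cdot n=g_h$ a.e. on $\Gamma_N$ and the following KKT conditions: for every $(y_h,\overline v_h,\eta_h)\in\mathcal{R}T^0_N(\mathcal{T}_h)\times\mathcal{L}^0(\mathcal{T}_h)\times\mathbb{R}$, $$(\Pi_hz_h^{rt},\Pi_hy_h)_\Omega+(\overline u_h,\mathrm{div}\,y_h)_\Omega+(\lambda_h^+-\lambda_h^-,y_h\cdot n)_{\Gamma_I}=(u_D^h,y_h\cdot n)_{\Gamma_D},$$ $$(\mathrm{div}\,z_h^{rt},\overline v_h)_\Omega=-(f_h,\overline v_h)_\Omega,$$ $$m\,\mu_h\,\eta_h+(\lambda_h^++\lambda_h^-,\eta_h)_{\Gamma_I}=0,$$ and, a.e. on $\Gamma_I$, $$\mu_h\pm z_h^{rt}\cdot n\ge0,\qquad\lambda_h^\pm(\mu_h\pm z_h^{rt}\cdot n)=0,\qquad\lambda_h^+,\lambda_h^-\le0.$$ Then a discrete primal solution $u_h^{cr}\in\mathcal{S}^{1,cr}(\mathcal{T}_h)$ (i.e. a minimizer of $I_h^{cr}$) is given by $$u_h^{cr}=\overline u_h+\Pi_hz_h^{rt}\cdot(\mathrm{id}_{\mathbb{R}^d}-\Pi_h\mathrm{id}_{\mathbb{R}^d})\in\mathcal{L}^1(\m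athcal{T}_h).$$
   Context: Setting. $\Omega\subseteq\mathbb{R}^d$, $d\in\mathbb{N}$, is a bounded simplicial (polyhedral) Lipschitz domain with outward unit normal $n$, whose boundary is split into three relatively open parts $\Gamma_I\neq\emptyset$, $\Gamma_D$, $\Gamma_N$, with $\partial\Omega=\overline{\Gamma}_I\cup\overline{\Gamma}_D\cup\overline{\Gamma}_N$. $(\cdot,\cdot)_\omega$ is the integral of the (Euclidean) product over $\omega$ (surface measure if $\omega\subseteq\partial\Omega$), $\|\cdot\|_{p,\omega}$ the $L^p(\omega)$-norm, $\|\cdot\|_\omega=\|\cdot\|_{2,\omega}$, $\langle v\rangle_\omega$ the integral mean. Mesh. $\mathcal{T}_h$ is a (conforming, simplicial) triangulation of $\Omega$ from a shape-regular family; $\mathcal{S}_h=\mathcal{S}_h^i\cup\mathcal{S}_h^\partial$ are its interior and boundary sides; $\mathcal{S}_h^X$, $X\in\{I,D,N\}$, are the boundary sides with interior contained in $\Gamma_X$, and $\mathcal{S}_h^\partial=\mathcal{S}_h^I\,\dot\cup\,\mathcal{S}_h^D\,\dot\cup\,\mathcal{S}_h^N$. $\mathcal{L}^k(\mathcal{T}_h)$ and $\mathcal{L}^k(\widehat{\mathcal{S}}_h)$ are the element-wise, resp. side-wise (on a set $\widehat{\mathcal S}_h$ of sides), polynomials of degree at most $k$. $\Pi_h$: element-wise mean, $\Pi_hv|_T=\langle v\rangle_T$; $\pi_h$: side-wise mean, $\pi_hv|_S=\langle v\rangle_S$ (componentwise for vector fields); $\mathrm{id}_{\mathbb{R}^d}(x)=x$,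 so $\Pi_h\mathrm{id}_{\mathbb{R}^d}|_T$ is the barycenter of $T$. Crouzeix–Raviart space: $\mathcal{S}^{1,cr}(\mathcal{T}_h)=\{v_h\in\mathcal{L}^1(\mathcal{T}_h): \text{the jump of }v_h\text{ across each }S\in\mathcal{S}_h^i\text{ has mean zero on }S\}$; $\nabla_h$ is the element-wise gradient. Raviart–Thomas space: $\mathcal{R}T^0(\mathcal{T}_h)=\{y_h\in(\mathcal{L}^1(\mathcal{T}_h))^d: y_h|_T\cdot n_T\text{ is constant on each side of }T\text{ for every }T\in\mathcal{T}_h,\text{ and the normal jump of }y_h\text{ vanishes across each }S\in\mathcal{S}_h^i\}$, and $\mathcal{R}T^0_N(\mathcal{T}_h)=\{y_h\in\mathcal{R}T^0(\mathcal{T}_h):y_h\cdot n=0\text{ a.e. on }\Gamma_N\}$. Data: $m>0$, $f_h\in\mathcal{L}^0(\mathcal{T}_h)$, $g_h\in\mathcal{L}^0(\mathcal{S}_h^N)$, $u_D^h\in\mathcal{L}^0(\mathcal{S}_h^D)$. Discrete primal functional $I_h^{cr}\colon\mathcal{S}^{1,cr}(\mathcal{T}_h)\to\mathbb{R}\cup\{+\infty\}$: $I_h^{cr}(v_h)=\tfrac12\|\nabla_hv_h\|_\Omega^2+\tfrac1{2m}\|\pi_hv_h\|_{1,\Gamma_I}^2-(f_h,\Pi_hv_h)_\Omega-(g_h,\pi_hv_h)_{\Gamma_N}$ if $\pi_hv_h=u_D^h$ a.e. on $\Gamma_D$, and $+\infty$ otherwise. *)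

(* Defs.v *)
From HB Require Import structures.
From mathcomp Require Import all_boot all_order all_algebra.
From mathcomp Require Import all_classical all_reals all_analysis.
Set Implicit Arguments.
Unset Strict Implicit.
Unset Printing Implicit Defensive.
Import Order.TTheory GRing.Theory Num.Theory.
Import numFieldNormedType.Exports.
Local Open Scope classical_set_scope.
Local Open Scope ring_scope.

Definition dot (R : realType) (d : nat) (u v : 'rV[R]_d) : R :=
  \sum_i u 0 i * v 0 i.

Definition bdry (T : topologicalType) (A : set T) : set T :=
  closure A `\` interior A.

(* Near each boundary point, Omega is the strict subgraph, in some unit
   direction e, of a Lipschitz function of the component orthogonal to e.
   (gamma is taken on the whole space, but is only evaluated on the hyperplane
   orthogonal to e; Lipschitz functions on a hyperplane extend.) *)
Definition lipschitz_boundary (R : realType) (d : nat) (Omega : set 'rV[R]_d) :=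
  forall x0, bdry Omega x0 ->
  exists (e : 'rV[R]_d) (r L : R) (gamma : 'rV[R]_d -> R),
    [/\ dot e e = 1, 0 < r,
        forall y y', `|gamma y - gamma y'| <= L * `|y - y'| &
        forall x, ball x0 r x ->
          (Omega x <-> dot x e < gamma (x - dot x e *: e))].

Definition bounded_lipschitz_domain (R : realType) (d : nat)
    (Omega : set 'rV[R]_d) :=
  [/\ open Omega, connected Omega, bounded_set Omega &
      lipschitz_boundary Omega].

Definition relatively_open (T : topologicalType) (B A : set T) :=
  exists2 U : set T, open U & A = U `&` B.

Definition boundary_splitting (R : realType) (d : nat)
    (Omega GI GD GN : set 'rV[R]_d) :=
  [/\ [/\ relatively_open (bdry Omega) GI, relatively_open (bdry Omega) GD &
          relatively_open (bdry Omega) GN],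
      [/\ GI `&` GD = set0, GI `&` GN = set0 & GD `&` GN = set0] &
      bdry Omega = closure GI `|` closure GD `|` closure GN].

(* A simplex is represented by its finite set of vertices, a mesh by the set
   of (vertex sets of) its elements. *)
Record mesh (R : realType) (d : nat) := Mesh {
  vert : finType;
  pt : vert -> 'rV[R]_d;
  elems : {set {set vert}}
}.

Section Mesh.
Context {R : realType} {d : nat} (M : mesh R d).
Local Notation V := (vert M).
Local Notation P := ('rV[R]_d).
Implicit Types (A S T : {set V}) (Shat : {set {set V}}).

Definition hull A : set P := [set x | exists w : V -> R,
  [/\ forall v, v \in A -> 0 <= w v, \sum_(v in A) w v = 1 &
      x = \sum_(v in A) w v *: pt v]].

Definition relint A : set P := [set x | exists w : V -> R,
  [/\ forall v, v \in A -> 0 < w v, \sum_(v in A) w v = 1 &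
      x = \sum_(v in A) w v *: pt v]].

Definition affinely_independent A := forall w : V -> R,
  \sum_(v in A) w v = 0 -> \sum_(v in A) w v *: pt v = 0 ->
  forall v, v \in A -> w v = 0.

Definition triangulation (Omega : set P) :=
  [/\ forall T, T \in elems M -> #|T| = d.+1 /\ affinely_independent T,
      forall T T', T \in elems M -> T' \in elems M ->
        hull T `&` hull T' = hull (T :&: T') &
      closure Omega = [set x | exists2 T, T \in elems M & hull T x]].

Definition sides : {set {set V}} :=
  [set S : {set V} | (#|S| == d) && [exists T in elems M, S \subset T]]%SET.

Definition int_sides : {set {set V}} :=
  [set S in sides | [exists T in elems M, exists T' in elems M,
                       (T != T') && (S == T :&: T')]]%SET.

Definition bdry_sides : {set {set V}} := sides :\: int_sides.

Definition sides_on (G : set P) : {set {set V}} :=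
  [set S in bdry_sides | `[< relint S `<=` G >]]%SET.

Definition resolves (GI GD GN : set P) :=
  [/\ bdry_sides = sides_on GI :|: sides_on GD :|: sides_on GN,
      sides_on GI :&: sides_on GD = finset.set0,
      sides_on GI :&: sides_on GN = finset.set0 &
      sides_on GD :&: sides_on GN = finset.set0].

(* Integral of f(t_1, ..., t_k) over the simplex t_i >= 0, t_1 + ... + t_k <= s
   with respect to k-dimensional Lebesgue measure, as an iterated integral. *)
Fixpoint refsimplex_int (k : nat) (s : R) (f : seq R -> R) : R :=
  if k is k'.+1 then
    \int[@lebesgue_measure R]_(t in `[0, s])
      refsimplex_int k' (s - t) (fun l => f (t :: l))
  else f [::].

Definition vertices A : seq P := [seq pt v | v <- enum A].

Definition edges A : 'M[R]_(#|A|.-1, d) :=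
  \matrix_(i < #|A|.-1) ((vertices A)`_i.+1 - (vertices A)`_0).

Definition param A (t : seq R) : P :=
  (vertices A)`_0 + (\row_(i < #|A|.-1) t`_i) *m edges A.

(* Integral over the simplex with vertex set A with respect to Hausdorff
   measure of dimension #|A| - 1, by the affine parametrization over the
   reference simplex: the volume integral for elements, the surface integral
   for sides (the counting measure of a point if d = 1). *)
Definition int_simplex A (f : P -> R) : R :=
  Num.sqrt (\det (edges A *m (edges A)^T))
  * refsimplex_int #|A|.-1 1 (f \o param A).

Definition mean A (f : P -> R) : R :=
  int_simplex A f / int_simplex A (fun=> 1).

Definition polynomial_fun (k : nat) (p : P -> R) :=
  exists c : {ffun 'I_d -> 'I_k.+1} -> R, forall x,
    p x = \sum_(a : {ffun 'I_d -> 'I_k.+1} | (\sum_i a i <= k)%N)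
            c a * \prod_i x 0 i ^+ a i.

(* Element-wise (side-wise) functions are families indexed by the elements
   (sides); on an element T the representative is the polynomial itself, hence
   defined on the whole space, whereas on a side S only the values on the hull
   of S are meaningful. The family at other vertex sets is irrelevant. *)
Definition sfield := {set V} -> P -> R.
Definition vfield := {set V} -> P -> P.
Implicit Types (u v : sfield) (y z : vfield).

Definition pw_poly (k : nat) v :=
  forall T, T \in elems M -> polynomial_fun k (v T).

Definition pw_vpoly (k : nat) y :=
  forall i, pw_poly k (fun T x => y T x 0 i).

Definition side_poly (k : nat) Shat v :=
  forall S, S \in Shat -> exists2 p, polynomial_fun k p &
    forall x, hull S x -> v S x = p x.

(* Equality (or any relation) of side-wise polynomials a.e. on a union of
   sides amounts to the relation at every point of each of these sides. *)
Definition on_sides Shat (Q : {set V} -> P -> Prop) :=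
  forall S, S \in Shat -> forall x, hull S x -> Q S x.

Definition grad_h v : vfield :=
  fun T x => \row_i 'D_(delta_mx 0 i : P) (v T) x.

Definition div_h y : sfield :=
  fun T x => \sum_i 'D_(delta_mx 0 i : P) (fun x' => y T x' 0 i) x.

(* Integral over the union of the simplices in B: the integral over Omega for
   B := elems M, and over Gamma_X for B := sides_on Gamma_X. *)
Definition mesh_int (B : {set {set V}}) (f : sfield) : R :=
  \sum_(A in B) int_simplex A (f A).

Definition inner B u v : R := mesh_int B (fun A x => u A x * v A x).
Definition vinner B y z : R := mesh_int B (fun A x => dot (y A x) (z A x)).

Definition norm1 B u : R := mesh_int B (fun A x => `|u A x|).
Definition vnorm2 B y : R := Num.sqrt (vinner B y y).

(* Simplex-wise means, on elements or on sides. *)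
Definition Pi_h v : sfield := fun A _ => mean A (v A).
Definition vPi_h y : vfield := fun A _ => \row_i mean A (fun x => y A x 0 i).

(* An element having S as a side: the only one if S is a boundary side. *)
Definition adj S : {set V} :=
  odflt finset.set0 [pick T in elems M | S \subset T].

Definition trace v : sfield := fun S => v (adj S).

(* Side-wise mean of an element-wise function; for a Crouzeix-Raviart function
   the means from both elements sharing an interior side agree. *)
Definition side_mean v : sfield := Pi_h (trace v).

(* Unit normal on the side S of T pointing out of T. *)
Definition outer_normal T S : P := xget 0 [set n : P |
  [/\ dot n n = 1,
      forall (v w : V), v \in S -> w \in S -> dot n (pt w - pt v) = 0 &
      forall (v w : V), v \in S -> w \in T -> w \notin S ->
        dot n (pt w - pt v) < 0]].

(* y . n on a boundary side, where the outward normal n of Omega is that of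
   the adjacent element. *)
Definition ntrace y : sfield :=
  fun S x => dot (y (adj S) x) (outer_normal (adj S) S).

Definition is_side_of S T := (#|S| == d) && (S \subset T).

Definition CR v :=
  pw_poly 1 v /\
  forall S T T', S \in int_sides -> T \in elems M -> T' \in elems M ->
    T != T' -> S \subset T -> S \subset T' ->
    mean S (fun x => v T x - v T' x) = 0.

Definition RT y :=
  [/\ pw_vpoly 1 y,
      forall T S, T \in elems M -> is_side_of S T ->
        exists c, forall x, hull S x -> dot (y T x) (outer_normal T S) = c &
      forall S T T', S \in int_sides -> T \in elems M -> T' \in elems M ->
        T != T' -> S \subset T -> S \subset T' -> forall x, hull S x ->
        dot (y T x) (outer_normal T S) + dot (y T' x) (outer_normal T' S) = 0].

Definition RT_N (GN : set P) y :=
  RT y /\ on_sides (sides_on GN) (fun S x => ntrace y S x = 0).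

Definition I_cr (GI GD GN : set P) (m : R) (f g uD : sfield) v : \bar R :=
  if `[< on_sides (sides_on GD) (fun S x => side_mean v S x = uD S x) >]
  then (2^-1 * vnorm2 (elems M) (grad_h v) ^+ 2
        + (2 * m)^-1 * norm1 (sides_on GI) (side_mean v) ^+ 2
        - inner (elems M) f (Pi_h v)
        - inner (sides_on GN) g (side_mean v))%:E
  else +oo%E.

Definition discrete_primal_solution (GI GD GN : set P) (m : R)
    (f g uD : sfield) u :=
  CR u /\
  forall v, CR v ->
    (I_cr GI GD GN m f g uD u <= I_cr GI GD GN m f g uD v)%E.

Definition reconstruction (ubar : sfield) z : sfield :=
  fun T x => ubar T x + dot (vPi_h z T x) (x - vPi_h (fun _ x' => x') T x).

End Mesh.

(* Main.v *)
(* All integrands are affine on simplices, so integrals reduce to volumes times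
   values at barycenters, and elementwise integration by parts turns the first
   KKT condition into a statement about the side means of
   [u := reconstruction ubar z]. Tested with the Raviart-Thomas basis field of
   a single side, it shows that u is Crouzeix-Raviart and that its side means are
   u_D on Gamma_D and lambda^- - lambda^+ on Gamma_I. Green's formula against z
   then bounds the energy difference to a competitor v from below by
   (a - m mu)^2 / (2 m), where a is the L^1-norm over Gamma_I of the side means
   of v; complementarity and the third KKT condition supply the terms of u. *)
Require Import Defs.
From mathcomp Require Import all_boot all_order all_algebra.
From mathcomp Require Import all_classical all_reals all_analysis.
From mathcomp Require Import perm ring lra.
Set Implicit Arguments.
Unset Strict Implicit.
Unset Printing Implicit Defensive.
Import Order.TTheory GRing.Theory Num.Theory.
Import numFieldNormedType.Exports.
Local Open Scope classical_set_scope.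
Local Open Scope ring_scope.

(** Side measures and unit normals both contain square roots. They are eliminated once and for all
    by vol(S) n = - d vol(T) grad(lambda_p), where S is the side of T opposite to p and lambda_p is
    the barycentric coordinate of p; from there on, Green's formula on an element is an identity
    between the gradients of barycentric coordinates. The mesh is given only by simplices whose
    hulls intersect in common faces. That no three elements share a side has to be derived from
    this: a flux 1 out of one element and -1 out of its neighbour would violate the jump condition
    if a third element contained the side. Green's formula is first proved for arbitrary
    element-wise affine functions, with the interior sides kept, because it serves to show that [u]
    is Crouzeix-Raviart. In the energy, the loads are replaced by the divergence and the normal
    trace of z; since the gradient of [u] is the projection of z, the volume terms then complete to
    a square centered at [u]. *)

(** * Integrals of affine functions over the reference simplex *)

(** Side-wise data and the normal traces of Raviart-Thomas fields are controlled only on the hull of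
    a side, so an integrand may be replaced only at parameters inside the reference simplex. *)
Lemma eq_refsimplex_int {R : realType} k (s : R) (f g : seq R -> R) :
  0 <= s ->
  (forall t, size t = k -> all (fun x => 0 <= x) t -> \sum_(x <- t) x <= s ->
    f t = g t) ->
  refsimplex_int k s f = refsimplex_int k s g.
Proof.
elim: k s f g => [|k IHk] s f g s0 fg /=; first by apply: fg; rewrite ?big_nil.
apply: eq_Rintegral => x; rewrite inE /= in_itv /= => /andP[x0 xs].
apply: IHk => [|t szt t0 ts]; first by rewrite subr_ge0.
by apply: fg => /=; rewrite ?szt ?x0 ?t0 ?big_cons -?lerBrDl.
Qed.

Lemma Rintegral_deriv_horner {R : realType} (q : {poly R}) (a b : R) : a <= b ->
  \int[@lebesgue_measure R]_(t in `[a, b]) (q^`()).[t] = q.[b] - q.[a].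
Proof.
rewrite le_eqVlt => /predU1P[<-|ab].
  by rewrite set_itv1 Rintegral_set1 subrr.
rewrite /Rintegral (@continuous_FTC2 _ _ (horner q)) //.
- exact/continuous_subspaceT/continuous_horner.
- split=> [x _| |]; first exact: derivable_horner.
  + exact/cvg_at_right_filter/continuous_horner.
  + exact/cvg_at_left_filter/continuous_horner.
- by move=> x _; rewrite derivE.
Qed.

(** These two powers are what an affine integrand leaves after integration of the k inner variables
    over a simplex of size s - t; antiderivatives in powers of s - t vanish at t = s. *)
Lemma Rintegral_pow2 {R : realType} (k : nat) (s c1 c2 : R) : 0 <= s ->
  \int[@lebesgue_measure R]_(t in `[0, s])
    (c1 * (s - t) ^+ k + c2 * (s - t) ^+ k.+1)
  = c1 * s ^+ k.+1 / k.+1%:R + c2 * s ^+ k.+2 / k.+2%:R.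
Proof.
move=> s0; have nz n : n.+1%:R != 0 :> R by rewrite pnatr_eq0.
pose q n c : {poly R} := (- (c / n.+1%:R)) *: (s%:P - 'X) ^+ n.+1.
have qE n c t : (q n c).[t] = - (c / n.+1%:R) * (s - t) ^+ n.+1.
  by rewrite hornerZ horner_exp hornerD hornerN hornerC hornerX.
have dqE n c t : ((q n c)^`()).[t] = c * (s - t) ^+ n.
  rewrite derivZ deriv_exp derivB derivC derivX sub0r hornerZ hornerMn mulN1r.
  rewrite hornerN horner_exp hornerD hornerN hornerC hornerX -[X in _ * X]mulr_natr.
  by rewrite !mulNr mulrN opprK mulrACA mulVf ?mulr1.
transitivity (\int[@lebesgue_measure R]_(t in `[0, s])
    ((q k c1 + q k.+1 c2)^`()).[t]).
  by apply: eq_Rintegral => t _; rewrite derivD hornerD !dqE.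
rewrite Rintegral_deriv_horner // !hornerD !qE subrr subr0 !expr0n /=.
rewrite !mulr0 addr0 sub0r !mulNr opprD !opprK.
by rewrite [c1 * _ / _]mulrAC [c2 * _ / _]mulrAC.
Qed.

(** The simplex of size s has volume s^k / k!, and each coordinate has integral s^(k+1) / (k+1)!.
    The size stays free because the induction passes from s to s - t, and [b] is indexed by nat so
    that it can be shifted. *)
Lemma refsimplex_int_affine {R : realType} k (s a : R) (b : nat -> R) : 0 <= s ->
  refsimplex_int k s (fun t => a + \sum_(i < k) b i * t`_i)
  = a * s ^+ k / k`!%:R + (\sum_(i < k) b i) * s ^+ k.+1 / k.+1`!%:R.
Proof.
elim: k s a b => [|k IHk] s a b s0 /=.
  by rewrite !big_ord0 expr0 expr1 mul0r mul0r !addr0 divr1 mulr1.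
have nz n : n.+1%:R != 0 :> R by rewrite pnatr_eq0.
have fnz n : n`!%:R != 0 :> R by rewrite pnatr_eq0 -lt0n fact_gt0.
(* The first variable enters through b_0 t = b_0 s - b_0 (s - t), which leaves only powers of s -
   t. *)
transitivity (\int[@lebesgue_measure R]_(t in `[0, s])
    ((a + b 0%N * s) / k`!%:R * (s - t) ^+ k +
     ((\sum_(i < k) b i.+1) / k.+1`!%:R - b 0%N / k`!%:R) * (s - t) ^+ k.+1)).
  apply: eq_Rintegral => t; rewrite inE /= in_itv /= => /andP[t0 ts].
  under [X in refsimplex_int _ _ X]funext do rewrite big_ord_recl /= addrA.
  rewrite (IHk _ (a + b 0%N * t) (fun i => b i.+1)) ?subr_ge0 //.
  rewrite factS natrM exprS; move: (nz k) (fnz k).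
  by move: k.+1%:R k`!%:R => N K N0 K0; field; apply/andP.
rewrite Rintegral_pow2 // big_ord_recl /= /bump /=.
under [in RHS]eq_bigr do rewrite add1n.
rewrite !factS !natrM !exprS -[k.+2%:R]natr1; move: (nz k) (nz k.+1) (fnz k).
rewrite -[k.+2%:R]natr1; move: k.+1%:R k`!%:R => N K N0 N10 K0.
by field; rewrite ?N0 ?N10 ?K0.
Qed.

(** * The Euclidean product *)

Section Dot.
Context {R : realType} {d : nat}.
Implicit Types (u v w : 'rV[R]_d).

Lemma dotC u v : dot u v = dot v u.
Proof. by apply: eq_bigr => i _; rewrite mulrC. Qed.

Lemma dotDr u v w : dot u (v + w) = dot u v + dot u w.
Proof. by rewrite -big_split; apply: eq_bigr => i _; rewrite !mxE mulrDr. Qed.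

Lemma dotZr u a v : dot u (a *: v) = a * dot u v.
Proof. by rewrite big_distrr; apply: eq_bigr => i _; rewrite !mxE mulrCA. Qed.

Lemma dotNr u v : dot u (- v) = - dot u v.
Proof. by rewrite -scaleN1r dotZr mulN1r. Qed.

Lemma dotBr u v w : dot u (v - w) = dot u v - dot u w.
Proof. by rewrite dotDr dotNr. Qed.

Lemma dot0r u : dot u 0 = 0.
Proof. by rewrite -(scale0r 0) dotZr mul0r. Qed.

Lemma dot_sumr u I (r : seq I) (P : pred I) (F : I -> 'rV[R]_d) :
  dot u (\sum_(i <- r | P i) F i) = \sum_(i <- r | P i) dot u (F i).
Proof. by apply: (big_morph (dot u)) => [v w|]; rewrite ?dotDr ?dot0r. Qed.

Lemma dotDl u v w : dot (u + v) w = dot u w + dot v w.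
Proof. by rewrite !(dotC _ w) dotDr. Qed.

Lemma dotZl a u w : dot (a *: u) w = a * dot u w.
Proof. by rewrite !(dotC _ w) dotZr. Qed.

Lemma dotBl u v w : dot (u - v) w = dot u w - dot v w.
Proof. by rewrite !(dotC _ w) dotBr. Qed.

Lemma dot0l u : dot 0 u = 0.
Proof. by rewrite dotC dot0r. Qed.

Lemma dot_suml I (r : seq I) (P : pred I) (F : I -> 'rV[R]_d) u :
  dot (\sum_(i <- r | P i) F i) u = \sum_(i <- r | P i) dot (F i) u.
Proof. by rewrite dotC dot_sumr; apply: eq_bigr => i _; rewrite dotC. Qed.

Lemma dot_ge0 u : 0 <= dot u u.
Proof. by apply: sumr_ge0 => i _; rewrite -expr2 sqr_ge0. Qed.

Lemma dot_eq0 u : (dot u u == 0) = (u == 0).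
Proof.
apply/eqP/eqP => [/psumr_eq0P u0|->]; last exact: dot0r.
apply/rowP => i; rewrite mxE; apply/eqP.
by rewrite -sqrf_eq0 expr2 u0 // => j _; rewrite -expr2 sqr_ge0.
Qed.

Lemma dot_mulmx u v : u *m v^T = (dot u v)%:M.
Proof.
apply/rowP => j; rewrite !mxE ord1 /= mulr1n.
by apply: eq_bigr => i _; rewrite mxE.
Qed.

End Dot.

(** * Exactness of the barycenter rule for affine functions *)

Section Barycenter.
Context {R : realType} {d : nat} {M : mesh R d}.
Local Notation V := (vert M).
Local Notation P := ('rV[R]_d).
Implicit Types (A : {set V}) (f : P -> R).

(** The reference simplex of dimension k has volume 1 / k!, so this is the Hausdorff measure of a
    simplex in closed form. *)
Definition vol A : R :=
  Num.sqrt (\det (edges A *m (edges A)^T)) / (#|A|.-1)`!%:R.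

Definition bary A : P := (#|A|%:R)^-1 *: \sum_(v in A) pt v.

Lemma bary_hull A : (0 < #|A|)%N -> hull A (bary A).
Proof.
move=> A0; exists (fun=> #|A|%:R^-1); split.
- by move=> v _; rewrite invr_ge0 ler0n.
- by rewrite sumr_const -[_ *+ _]mulr_natr mulVf // pnatr_eq0 -lt0n.
- by rewrite /bary scaler_sumr.
Qed.

Lemma enum_cons A : (0 < #|A|)%N -> exists v s, enum A = v :: s.
Proof. by rewrite cardE; case: (enum A) => // v s _; exists v, s. Qed.

Lemma param_hull A (t : seq R) : (0 < #|A|)%N -> size t = #|A|.-1 ->
  all (fun x => 0 <= x) t -> \sum_(x <- t) x <= 1 -> hull A (param A t).
Proof.
move=> /enum_cons[v0 [s eA]]; rewrite /param /edges /vertices eA.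
have -> : #|A| = (size s).+1 by rewrite cardE eA.
move=> /= szt t0 t1; have := enum_uniq A; rewrite eA /= => /andP[v0s us].
(* Each edge from [v0] passes its coefficient on to its end vertex; the base vertex keeps the
   rest. *)
pose w v := if v == v0 then 1 - \sum_(x <- t) x else t`_(index v s).
have wE (W : nmodType) (F : R -> V -> W) : \sum_(v in A) F (w v) v =
    F (1 - \sum_(x <- t) x) v0 + \sum_(i < size s) F t`_i (nth v0 s i).
  rewrite -big_enum eA big_cons {1}/w eqxx (big_nth v0) big_mkord.
  congr (_ + _); apply: eq_bigr => i _; rewrite /w index_uniq //.
  by case: eqP => // e; rewrite -e mem_nth in v0s.
exists w; split.
- move=> v vA; rewrite /w; case: eqP => _; first by rewrite subr_ge0.
  have [it|it] := ltnP (index v s) (size t); last by rewrite nth_default.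
  exact: (all_nthP 0 t0).
- rewrite (wE _ (fun x _ => x)) (big_nth 0) szt big_mkord subrK //.
- rewrite (wE _ (fun x v => x *: pt v)) mulmx_sum_row (big_nth 0) szt big_mkord.
  rewrite scalerBl scale1r -addrA; congr (_ + _).
  rewrite scaler_suml -sumrN -big_split; apply: eq_bigr => i _ /=.
  rewrite rowK !mxE (nth_map v0) // scalerBr.
  by rewrite addrC.
Qed.

(** On the reference simplex of dimension k every coordinate has mean 1 / (k+1), the weight of each
    vertex in the barycenter. Affinity is required only on the hull, which is all that is known on
    sides. *)
Lemma int_simplex_affine A f (a : R) (b : P) : (0 < #|A|)%N ->
  (forall x, hull A x -> f x = a + dot b x) ->
  int_simplex A f = vol A * (a + dot b (bary A)).
Proof.
move=> A0 fE; rewrite /int_simplex /vol -!mulrA; congr (_ * _).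
have [v0 [s eA]] := enum_cons A0.
pose b' i := dot b (pt (nth v0 s i)) - dot b (pt v0).
transitivity (refsimplex_int #|A|.-1 1
   (fun t => (a + dot b (pt v0)) + \sum_(i < #|A|.-1) b' i * t`_i)).
  apply: eq_refsimplex_int => // t szt t0 t1 /=.
  rewrite fE; last exact: param_hull.
  rewrite /param /edges /vertices eA -addrA dotDr /=; congr (_ + (_ + _)).
  rewrite mulmx_sum_row dot_sumr; apply: eq_bigr => i _.
  rewrite rowK !mxE dotZr mulrC dotBr (nth_map v0) //.
  by apply: leq_trans (ltn_ord i) _; rewrite cardE eA.
rewrite refsimplex_int_affine // !expr1n !mulr1 /bary -[X in _ *: X]big_enum eA big_cons.
have -> : #|A| = (size s).+1 by rewrite cardE eA.
rewrite (big_nth v0) big_mkord dotZr dotDr dot_sumr /= factS natrM.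
rewrite sumrB sumr_const card_ord -[X in _ - X]mulr_natr -natr1.
have := ler0n R (size s); have : (size s)`!%:R != 0 :> R by rewrite pnatr_eq0 -lt0n fact_gt0.
move: (\sum_(i < _) _) (dot b _) (_`!%:R) => X y K K0.
move: (size s)%:R => n n0.
by field; rewrite K0 /= lt0r_neq0 // ltr_wpDl.
Qed.

End Barycenter.

(** * Polynomials of degree at most one as affine functions *)

Section PolynomialFun.
Context {R : realType} {d : nat}.
Local Notation P := ('rV[R]_d).
Implicit Types p q : P -> R.

Lemma polynomial_fun_monomial k (c : R) (a0 : {ffun 'I_d -> 'I_k.+1}) :
  (\sum_i a0 i <= k)%N ->
  polynomial_fun k (fun x : P => c * \prod_i x 0 i ^+ a0 i).
Proof.
move=> ka0; exists (fun a => if a == a0 then c else 0) => x.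
rewrite (bigD1 a0) //= eqxx [X in _ + X]big1 ?addr0 // => a /andP[_ /negPf->].
by rewrite mul0r.
Qed.

Lemma polynomial_fun_cst k (c : R) : polynomial_fun k (fun _ : P => c).
Proof.
have := @polynomial_fun_monomial k c [ffun=> ord0].
rewrite (eq_bigr (fun=> 0%N)) => [|i _]; last by rewrite ffunE.
rewrite big1 // => /(_ isT)[e E]; exists e => x.
rewrite -E big1 ?mulr1 // => i _; by rewrite ffunE expr0.
Qed.

Lemma polynomial_funD k p q :
  polynomial_fun k p -> polynomial_fun k q ->
  polynomial_fun k (fun x => p x + q x).
Proof.
move=> [e pE] [h qE]; exists (fun a => e a + h a) => x.
by rewrite pE qE -big_split; apply: eq_bigr => a _; rewrite /= mulrDl.
Qed.

Lemma polynomial_fun0P p : polynomial_fun 0 p <-> exists c, forall x, p x = c.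
Proof.
split=> [[c pE]|[c pE]]; last first.
  by have [e E] := polynomial_fun_cst 0 c; exists e => x; rewrite pE -E.
exists (\sum_(a : {ffun 'I_d -> 'I_1} | (\sum_i a i <= 0)%N) c a) => x.
rewrite pE; apply: eq_bigr => a _; rewrite big1 ?mulr1 // => i _.
by rewrite ord1 expr0.
Qed.

Lemma polynomial_fun1P p :
  polynomial_fun 1 p <-> exists a (b : P), forall x, p x = a + dot b x.
Proof.
split=> [[c pE]|[a [b pE]]].
- have {pE} -> : p = fun x => \sum_(a : {ffun 'I_d -> 'I_2} | (\sum_i a i <= 1)%N)
            c a * \prod_i x 0 i ^+ a i by apply/funext.
  (* A monomial of total degree at most one is a constant or a single coordinate, hence affine by
     itself. *)
  suff : forall a : {ffun 'I_d -> 'I_2}, exists ab : R * P,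
      (\sum_i a i <= 1)%N -> forall x : P, c a * \prod_i x 0 i ^+ a i = ab.1 + dot ab.2 x.
    move=> /choice[ab abE].
    exists (\sum_(a : {ffun 'I_d -> 'I_2} | (\sum_i a i <= 1)%N) (ab a).1).
    exists (\sum_(a : {ffun 'I_d -> 'I_2} | (\sum_i a i <= 1)%N) (ab a).2) => x.
    by rewrite dot_suml -big_split; apply: eq_bigr => a /abE ->.
  move=> a; case: (boolP [exists i, a i == 1%N :> nat]) => [/existsP[i /eqP ai]|].
    exists (0, c a *: delta_mx 0 i) => + x; rewrite (bigD1 i) //= ai => sa.
    have a0 j : j != i -> a j = 0%N :> nat.
      move=> ji; apply/eqP; move: sa; rewrite (bigD1 j) //= -leqn0.
      by apply: contraTT; rewrite -!ltnNge => aj; rewrite ltnS addn_gt0 aj.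
    rewrite add0r dotZl; congr (_ * _).
    rewrite (bigD1 i) //= ai expr1 big1 ?mulr1 => [|j ji]; last by rewrite a0 ?expr0.
    rewrite /dot (bigD1 i) //= mxE !eqxx mul1r big1 ?addr0 // => j ji.
    by rewrite mxE (negPf ji) andbF mul0r.
  rewrite negb_exists => /forallP a0; exists (c a, 0) => _ x /=.
  rewrite dot0l addr0 big1 ?mulr1 // => i _.
  by have := a0 i; case: (a i) => -[|[|//]].
- have -> : p = fun x => a + dot b x by apply/funext.
  apply: polynomial_funD; first exact: polynomial_fun_cst.
  rewrite /dot; elim: (index_enum _) => [|i s IHs].
    have -> : (fun x : P => \sum_(i <- [::]) b 0 i * x 0 i) = fun=> 0.
      by apply/funext => x; rewrite big_nil.
    exact: polynomial_fun_cst.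
  have -> : (fun x : P => \sum_(i <- i :: s) b 0 i * x 0 i) =
      fun x => b 0 i * x 0 i + \sum_(i <- s) b 0 i * x 0 i.
    by apply/funext => x; rewrite big_cons.
  apply: polynomial_funD => //.
  pose e : {ffun 'I_d -> 'I_2} := [ffun j => if j == i then Ordinal (isT : 1 < 2)%N else ord0].
  have := @polynomial_fun_monomial 1 (b 0 i) e.
  rewrite (bigD1 i) //= ffunE eqxx big1 => [/(_ isT)[h E]|j /negPf ji]; last by rewrite ffunE ji.
  exists h => x; rewrite -E; congr (_ * _).
  rewrite (bigD1 i) //= ffunE eqxx big1 ?mulr1 ?expr1 // => j /negPf ji.
  by rewrite ffunE ji.
Qed.

(** The difference quotient is exactly b_i for every nonzero step, so the limit is that of an
    eventually constant function. *)
Lemma derive_affine p (a : R) (b : P) x i : (forall x, p x = a + dot b x) ->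
  'D_(delta_mx 0 i : P) p x = b 0 i.
Proof.
move=> pE; rewrite /derive; apply: lim_near_cst; first exact: norm_hausdorff.
near=> h; have h0 : h != 0 by near: h; exact: nbhs_dnbhs_neq.
rewrite /= !pE opprD addrACA subrr add0r dotDr addrK dotZr.
rewrite scalerA mulVf // scale1r /dot (bigD1 i) //= mxE !eqxx mulr1 big1 ?addr0 //.
by move=> j /negPf ji; rewrite mxE ji andbF mulr0.
Unshelve. all: by end_near. Qed.

End PolynomialFun.

(** * Volumes as determinants in homogeneous coordinates *)

Section HomogeneousDet.
Context {R : realType} {d : nat}.
Local Notation P := ('rV[R]_d).
Implicit Types (s : seq P).

(** The absolute value of its determinant is d! times the volume of the simplex spanned by d+1
    points. Unlike the matrix of edges, it singles out no base vertex, so points can be permuted and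
    replaced freely. *)
Definition hom_mx s : 'M[R]_(1 + d) := \matrix_(i < 1 + d) row_mx 1%:M (s`_i).

Lemma normr_det_hom_mx_perm s s' : size s = d.+1 -> perm_eq s s' ->
  `|\det (hom_mx s)| = `|\det (hom_mx s')|.
Proof.
move=> szs ss'; have szs' : size s' == d.+1 by rewrite -(perm_size ss') szs.
have /tuple_permP[g sE] : perm_eq s (Tuple szs') by [].
have -> : hom_mx s = row_perm g (hom_mx s').
  apply/matrixP => i j; rewrite !mxE sE.
  by rewrite -(tnth_nth 0 (mktuple _)) tnth_mktuple (tnth_nth 0).
by rewrite row_permE det_mulmx det_perm normrM normrX normrN1 expr1n mul1r.
Qed.

Lemma det_hom_mx s :
  \det (hom_mx s) = \det (\matrix_(i < d) (s`_i.+1 - s`_0)).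
Proof.
pose L : 'M[R]_(1 + d) := block_mx 1%:M 0 (- const_mx 1) 1%:M.
have -> : \det (hom_mx s) = \det (L *m hom_mx s).
  by rewrite det_mulmx det_lblock !det1 !mul1r.
have -> : hom_mx s = block_mx 1%:M (s`_0) (const_mx 1) (\matrix_(i < d) s`_i.+1).
  apply/row_matrixP => i; rewrite rowK.
  case: (split_ordP i) => j ->.
    by rewrite rowKu (ord1 j) row_id.
  rewrite rowKd row_row_mx rowK; congr row_mx.
  by apply/rowP => k; rewrite !mxE ord1.
rewrite mulmx_block !mul1mx !mul0mx !addr0 mulmx1 addNr.
rewrite det_ublock det1 mul1r; congr (\det _).
apply/row_matrixP => i; rewrite raddfD /= mulNmx raddfN /= row_mul !rowK.
rewrite addrC; congr (_ - _); apply/rowP => j; rewrite !mxE big_ord1.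
by rewrite !mxE mul1r.
Qed.

End HomogeneousDet.

(* With the unit normal n added as an edge, the edge matrix becomes square and
   its Gram matrix is block diagonal with blocks 1 and E E^T. *)
Lemma det_gram_normal {R : realType} {d : nat} (q n : 'rV[R]_d) (s : seq 'rV[R]_d) :
  (0 < d)%N -> dot n n = 1 ->
  (forall i, (i < d.-1)%N -> dot n (s`_i - q) = 0) ->
  let E := \matrix_(i < d.-1) (s`_i - q) in
  \det (E *m E^T) = (\det (hom_mx [:: q, q + n & s])) ^+ 2.
Proof.
case: d q n s => // d q n s _ nn nE E; rewrite det_hom_mx.
set F := (X in \det X ^+ 2); rewrite expr2 -[X in _ = _ * X]det_tr -det_mulmx.
have FE : F = col_mx n E.
  apply/row_matrixP => i; rewrite rowK; case: (@split_ordP 1 d i) => j ->.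
    by rewrite [RHS](rowKu j n E) (ord1 j) row_id /= addrC addKr.
  by rewrite [RHS](rowKd j n E) rowK.
have nE0 : n *m E^T = 0.
  apply/rowP => j; rewrite !mxE -[RHS](nE j) //.
  by apply: eq_bigr => k _; rewrite !mxE.
have En0 : E *m n^T = 0 by rewrite -[LHS]trmxK trmx_mul trmxK nE0 trmx0.
have -> : F *m F^T = block_mx (n *m n^T) (n *m E^T) (E *m n^T) (E *m E^T).
  by rewrite FE; exact: etrans (congr1 _ (tr_col_mx n E)) (mul_col_row n E n^T E^T).
rewrite dot_mulmx nn nE0 En0.
by have := det_ublock (1%:M : 'M[R]_1) 0 (E *m E^T); rewrite det1 mul1r => <-.
Qed.

(** * Barycentric coordinates of an element *)

Section Barycentric.
Context {R : realType} {d : nat} {M : mesh R d}.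
Local Notation V := (vert M).
Local Notation P := ('rV[R]_d).
Implicit Types (T : {set V}) (c : V -> R) (G : V -> P).

(* [fun x => c v + dot (G v) x] is the barycentric coordinate of the vertex v. *)
Definition barycentric T c G :=
  [/\ forall v w, v \in T -> w \in T -> c v + dot (G v) (pt w) = (v == w)%:R,
      \sum_(v in T) c v = 1, \sum_(v in T) G v = 0,
      \sum_(v in T) c v *: pt v = 0 &
      forall i j, \sum_(v in T) G v 0 i * pt v 0 j = (i == j)%:R].

(** The matrix [A] with rows (1, pt v) is invertible by affine independence, and the columns of its
    inverse [B] hold the coefficients. A B = 1 gives the nodal values; the four blocks of B A = 1
    give the four sums. *)
Lemma barycentric_exists T : #|T| = d.+1 -> affinely_independent T ->
  exists c G, barycentric T c G.
Proof.
move=> cT aT; have /card_gt0P[v0 v0T] : (0 < #|T|)%N by rewrite cT.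
pose Pm : 'M[R]_(#|T|, d) := \matrix_(i < #|T|) pt (enum_val i).
pose A : 'M[R]_(#|T|, 1 + d) := row_mx (const_mx 1) Pm.
pose rk := enum_rank_in v0T.
have rkK v : v \in T -> enum_val (rk v) = v by move=> vT; rewrite enum_rankK_in.
have freeA : row_free A.
  apply: inj_row_free => u; rewrite mul_mx_row -[X in _ = X]row_mx0.
  move=> /eq_row_mx[u1 uP]; apply/rowP => i; rewrite mxE -(enum_valK_in v0T i).
  apply: (aT (fun v => u 0 (rk v))) (enum_valP i).
  - rewrite big_enum_val; move/rowP/(_ 0): u1; rewrite !mxE => u1; rewrite -[RHS]u1.
    by apply: eq_bigr => j _; rewrite /rk enum_valK_in [const_mx _ _ _]mxE mulr1 ?mxE.
  - rewrite big_enum_val -[RHS]uP mulmx_sum_row; apply: eq_bigr => j _.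
    by rewrite rowK /rk enum_valK_in.
have /row_freeP[B AB] := freeA.
(* [A] is square only through [cT], so the left inverse comes from the rank and is then identified
   with [B]. *)
have /row_fullP[B' BA'] : row_full A by rewrite /row_full (eqP freeA) cT.
have {B' BA'} BA : B *m A = 1%:M.
  suff -> : B = B' by [].
  by rewrite -[B]mul1mx -BA' -mulmxA AB mulmx1.
exists (fun v => usubmx B 0 (rk v)), (fun v => (col (rk v) (dsubmx B))^T).
move: AB BA; rewrite -[B]vsubmxK; set uB := usubmx B; set dB := dsubmx B.
rewrite col_mxKu col_mxKd mul_row_col mul_col_row scalar_mx_block.
move=> /matrixP AB /eq_block_mx[B1 B2 B3 B4]; split.
- move=> v w vT wT; have := AB (rk w) (rk v); rewrite !mxE big_ord1 !mxE mul1r.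
  have -> : (v == w) = (rk w == rk v).
    by rewrite -(inj_eq enum_val_inj) !rkK // eq_sym.
  move=> <-; congr (_ + _); apply: eq_bigr => k _; rewrite !mxE rkK //.
  by rewrite mulrC.
- move/matrixP/(_ 0 0): B1; rewrite !mxE => B1; rewrite big_enum_val -[RHS]B1.
  by apply: eq_bigr => j _; rewrite /rk enum_valK_in [const_mx _ _ _]mxE mulr1 ?mxE.
- apply/rowP => k; rewrite summxE big_enum_val mxE.
  move/matrixP/(_ k 0): B3; rewrite !mxE => B3; rewrite -[RHS]B3.
  by apply: eq_bigr => j _; rewrite /rk enum_valK_in [const_mx _ _ _]mxE mulr1 !mxE.
- rewrite big_enum_val -[RHS]B2 mulmx_sum_row; apply: eq_bigr => j _.
  by rewrite rowK /rk enum_valK_in.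
- move=> i j; move/matrixP/(_ i j): B4; rewrite !mxE => B4; rewrite big_enum_val -[RHS]B4.
  by apply: eq_bigr => k _; rewrite !mxE /rk enum_valK_in.
Qed.

Section Coordinates.
Variables (T : {set V}) (c : V -> R) (G : V -> P).
Hypothesis bT : barycentric T c G.

Lemma barycentric_coord v w : v \in T -> w \in T ->
  c v + dot (G v) (pt w) = (v == w)%:R.
Proof. by case: bT => cG _ _ _ _; apply: cG. Qed.

Lemma barycentric_sum1 x : \sum_(v in T) (c v + dot (G v) x) = 1.
Proof.
by case: bT => _ c1 G0 _ _; rewrite big_split /= c1 -dot_suml G0 dot0l addr0.
Qed.

Lemma barycentric_repr x : \sum_(v in T) (c v + dot (G v) x) *: pt v = x.
Proof.
case: bT => _ _ _ c0 GP; under eq_bigr do rewrite scalerDl.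
rewrite big_split /= c0 add0r; apply/rowP => j; rewrite summxE.
under eq_bigr => v do rewrite mxE /dot mulr_suml.
rewrite exchange_big /= (bigD1 j) //= [X in _ + X]big1 => [|i ij].
  rewrite addr0 -[RHS]mul1r -[1]/(true%:R) -(eqxx j) -GP mulr_suml.
  by apply: eq_bigr => v _; rewrite mulrAC.
under eq_bigr => v do rewrite mulrAC.
by rewrite -mulr_suml GP (negPf ij) mul0r.
Qed.

(** The sum of the matrices (G v)^T (pt v) is the identity; read in this direction, it expands a
    normal vector in the gradients. *)
Lemma dual_barycentric_repr x : \sum_(v in T) dot x (pt v) *: G v = x.
Proof.
case: bT => _ _ _ _ GP; apply/rowP => i; rewrite summxE.
under eq_bigr => v do rewrite mxE /dot mulr_suml.
rewrite exchange_big /= (bigD1 i) //= [X in _ + X]big1 => [|j ij].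
  rewrite addr0 -[RHS]mulr1 -[1]/(true%:R) -(eqxx i) -GP mulr_sumr.
  by apply: eq_bigr => v _; rewrite -mulrA (mulrC (pt v _ _)).
under eq_bigr => v do rewrite -mulrA (mulrC (pt v _ _)).
by rewrite -mulr_sumr GP eq_sym (negPf ij) mulr0.
Qed.

Lemma affine_barycentric (a : R) (b x : P) :
  a + dot b x = \sum_(v in T) (c v + dot (G v) x) * (a + dot b (pt v)).
Proof.
under eq_bigr do rewrite mulrDr -dotZr.
by rewrite big_split /= -mulr_suml barycentric_sum1 mul1r -dot_sumr barycentric_repr.
Qed.

End Coordinates.
End Barycentric.

(** * Normals and measures of the sides of a simplex *)

Section Simplex.
Context {R : realType} {d : nat} {M : mesh R d}.
Local Notation V := (vert M).
Local Notation P := ('rV[R]_d).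
Variables (T : {set V}) (c : V -> R) (G : V -> P).
Hypotheses (d_gt0 : (0 < d)%N) (cT : #|T| = d.+1) (bT : barycentric T c G).

Let S p : {set V} := (T :\ p)%SET.

Lemma card_face p : p \in T -> #|S p| = d.
Proof. by move=> pT; apply: succn_inj; rewrite -cT (cardsD1 p T) pT. Qed.

Lemma face_neq0 p : p \in T -> exists2 q, q \in S p & q \in T.
Proof.
move=> pT; have /card_gt0P[q qS] : (0 < #|S p|)%N by rewrite card_face.
by exists q => //; move: qS; rewrite !inE => /andP[].
Qed.

Lemma dot_grad_gt0 p : p \in T -> 0 < dot (G p) (G p).
Proof.
move=> pT; rewrite lt0r dot_ge0 dot_eq0 andbT; apply/eqP => Gp0.
have [q + qT] := face_neq0 pT; rewrite !inE qT andbT => qp.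
have := barycentric_coord bT pT qT.
have := barycentric_coord bT pT pT.
rewrite eqxx Gp0 !dot0l !addr0 => ->; rewrite eq_sym (negPf qp) => /eqP.
by rewrite oner_eq0.
Qed.

(** [xget] is meaningful only on a nonempty set. The witness is the normalized vector - G p: the
    coordinate of p vanishes on the face and grows towards p. *)
Lemma outer_normalP p : p \in T ->
  let n := outer_normal T (S p) in
  [/\ dot n n = 1,
      forall v w, v \in S p -> w \in S p -> dot n (pt w - pt v) = 0 &
      forall v w, v \in S p -> w \in T -> w \notin S p -> dot n (pt w - pt v) < 0].
Proof.
move=> pT n; rewrite /n /outer_normal.
have G0 := dot_grad_gt0 pT; have sG0 : 0 < Num.sqrt (dot (G p) (G p)) by rewrite sqrtr_gt0.
have cE v w : v \in T -> w \in T -> dot (G p) (pt w - pt v) = (p == w)%:R - (p == v)%:R.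
  move=> vT wT; rewrite -!(barycentric_coord bT pT) // dotBr.
  by rewrite opprD addrACA subrr add0r.
set Q := (X in xget 0 X); change (Q (xget 0 Q)).
apply: (@xgetI _ 0 Q (- (Num.sqrt (dot (G p) (G p)))^-1 *: G p)); split.
- rewrite dotZl dotZr mulrA mulrNN -expr2 -[X in _ * X]sqr_sqrtr ?dot_ge0 //.
  by rewrite -exprMn mulVf ?expr1n // gt_eqF.
- move=> v w; rewrite !inE => /andP[vp vT] /andP[wp wT].
  by rewrite dotZl cE // ![p == _]eq_sym (negPf vp) (negPf wp) subrr mulr0.
- move=> v w; rewrite !inE => /andP[vp vT] wT; rewrite wT andbT negbK => /eqP ->.
  by rewrite dotZl cE // eqxx eq_sym (negPf vp) subr0 mulr1 oppr_lt0 invr_gt0.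
Qed.

(** A vector orthogonal to the face keeps only its [G p] component in the dual expansion; the unit
    length fixes the factor up to sign, and outwardness fixes the sign. *)
Lemma outer_normal_grad p : p \in T ->
  outer_normal T (S p) = - (Num.sqrt (dot (G p) (G p)))^-1 *: G p.
Proof.
move=> pT; have [] := outer_normalP pT; set n := outer_normal _ _ => nn n0 n1.
have [q qS qT] := face_neq0 pT.
have pS : p \notin S p by rewrite !inE eqxx.
pose k := dot n (pt p - pt q); have k0 : k < 0 := n1 _ _ qS pT pS.
have nG : n = k *: G p.
  rewrite -[LHS](dual_barycentric_repr bT).
  (* As the gradients sum to zero, subtracting one constant from all coefficients changes nothing
     and kills those of the face. *)
  have e0 : \sum_(v in T) dot n (pt q) *: G v = 0.
    by have [_ _ sG0 _ _] := bT; rewrite -scaler_sumr sG0 scaler0.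
  rewrite -[LHS]subr0 -[X in _ - X]e0 -sumrB (bigD1 p) //= -scalerBl -dotBr big1 ?addr0 // => v.
  move=> /andP[vT vp]; rewrite -scalerBl -dotBr n0 ?scale0r //.
  by rewrite !inE vp.
move: nn; rewrite nG dotZl dotZr mulrA -expr2 => kG; congr (_ *: _).
have : (k * Num.sqrt (dot (G p) (G p))) ^+ 2 = 1 by rewrite exprMn sqr_sqrtr ?dot_ge0.
have G0 : 0 < Num.sqrt (dot (G p) (G p)) by rewrite sqrtr_gt0 dot_grad_gt0.
move/eqP; rewrite sqrf_eq1 => /orP[]/eqP kG1.
  by have := pmulr_rlt0 k G0; rewrite k0 mulrC kG1 ltr10.
by rewrite -[LHS](mulfK (lt0r_neq0 G0)) kG1 mulN1r.
Qed.

(** Cramer's rule: with the vertex p replaced by x, the determinant is proportional to the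
    coordinate of p at x. *)
Lemma det_hom_mx_bary p : p \in T -> exists l, forall x,
  l * \det (hom_mx (x :: [seq pt v | v <- enum (S p)])) = c p + dot (G p) x.
Proof.
move=> pT; pose e := p :: enum (S p).
have sze : size e = d.+1 by rewrite /= -cardE card_face.
have eT v : v \in e -> v \in T.
  by rewrite inE mem_enum !inE => /predU1P[->|/andP[]].
have ue : uniq e by rewrite /= enum_uniq mem_enum !inE eqxx.
pose L : 'M[R]_(1 + d) := \matrix_(j < 1 + d) row_mx (c (nth p e j))%:M (G (nth p e j)).
exists (\det L) => x; set X := hom_mx _.
have XL i j : (X *m L^T) i j =
    c (nth p e j) + dot (G (nth p e j)) (x :: [seq pt v | v <- enum (S p)])`_i.
  have -> : (X *m L^T) i j = (row i X *m (row j L)^T) 0 0.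
    by rewrite !mxE; apply: eq_bigr => k _; rewrite [LHS]mulrC [RHS]mulrC !mxE.
  rewrite !rowK tr_row_mx mul_row_col mul1mx tr_scalar_mx dot_mulmx.
  by rewrite !mxE eqxx !mulr1n dotC.
have eTn k : (k < d.+1)%N -> nth p e k \in T.
  by move=> kd; apply/eT/mem_nth; rewrite sze.
(* All rows but the first come from vertices of T and are unit rows, so X L^T is triangular and its
   determinant is the corner entry, the coordinate of p at x. *)
have XL' (i j : 'I_d.+1) : (0 < i)%N -> (X *m L^T) i j = (j == i)%:R.
  case: i => -[//|i] /= id _; rewrite XL /= (nth_map p) -?cardE ?card_face //.
  rewrite -[nth p (enum _) i]/(nth p e i.+1) (barycentric_coord bT) ?eTn //.
  by rewrite nth_uniq ?sze.
rewrite mulrC -[\det L]det_tr -det_mulmx -det_tr det_trig.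
  rewrite big_ord_recl big1 ?mulr1 => [|i _].
    by rewrite mxE XL.
  by rewrite mxE XL' ?eqxx.
apply/is_trig_mxP => i j ij; rewrite mxE XL'; last exact: leq_ltn_trans ij.
by rewrite -val_eqE /= (ltn_eqF ij).
Qed.

Let D := `|\det (hom_mx (vertices T))|.

Lemma vertices_face_perm p : p \in T ->
  perm_eq (vertices T) (pt p :: [seq pt v | v <- enum (S p)]).
Proof.
move=> pT; apply: (perm_map (@pt _ _ M) (t := p :: _)); apply: uniq_perm.
- exact: enum_uniq.
- by rewrite /= enum_uniq mem_enum !inE eqxx.
- by move=> v; rewrite !inE !mem_enum !inE; case: eqP => // ->.
Qed.

Lemma size_vertices : size (vertices T) = d.+1.
Proof. by rewrite size_map -cardE. Qed.

(** The unknown factor of Cramer's rule drops out by comparison with x = pt p, where the coordinate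
    is 1. *)
Lemma normr_det_hom_mx_cons x p : p \in T ->
  `|\det (hom_mx (x :: [seq pt v | v <- enum (S p)]))| = `|c p + dot (G p) x| * D.
Proof.
move=> pT; have [l lE] := det_hom_mx_bary pT.
rewrite /D (normr_det_hom_mx_perm size_vertices (vertices_face_perm pT)).
rewrite -lE -normrM mulrAC lE (barycentric_coord bT) // eqxx mul1r.
by [].
Qed.

Lemma vol_simplex : vol T = D / d`!%:R.
Proof.
rewrite /vol /edges cT /=; congr (_ / _).
rewrite det_mulmx det_tr -expr2 sqrtr_sqr /D det_hom_mx.
by [].
Qed.

Lemma vol_simplex_gt0 : 0 < vol T.
Proof.
rewrite vol_simplex divr_gt0 ?ltr0n ?fact_gt0 // normr_gt0; apply/eqP => D0.
have /card_gt0P[p pT] : (0 < #|T|)%N by rewrite cT.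
have := normr_det_hom_mx_cons (pt p) pT; rewrite /D D0 normr0 mulr0.
have [l lE] := det_hom_mx_bary pT; move/normr0_eq0 => /(congr1 ( *%R l)).
by rewrite lE (barycentric_coord bT) // eqxx mulr0 => /eqP; rewrite oner_eq0.
Qed.

(** The length of [G p] is the reciprocal of the height of p over the face. In the proof the apex is
    replaced by pt q + n with q on the face: the resulting simplex has height 1, and the coordinate
    of p at its apex is minus the length of [G p]. *)
Lemma vol_face p : p \in T ->
  vol (S p) = d%:R * vol T * Num.sqrt (dot (G p) (G p)).
Proof.
move=> pT; have [] := outer_normalP pT; have nG := outer_normal_grad pT.
set n := outer_normal _ _ in nG *; move=> nn n0 _.
have [|q [s eS]] := @enum_cons _ _ M (S p); first by rewrite card_face.
have qS : q \in S p by rewrite -mem_enum eS mem_head.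
have vE i : (vertices (S p))`_i.+1 = [seq pt v | v <- s]`_i by rewrite /vertices eS.
have v0 : (vertices (S p))`_0 = pt q by rewrite /vertices eS.
have szs : size s = d.-1.
  by apply: succn_inj; rewrite prednK // -[RHS](card_face pT) cardE eS.
rewrite {1}/vol /edges card_face // v0.
under [in \det _]eq_mx do rewrite vE.
rewrite (det_gram_normal d_gt0 nn) => [|i id]; last first.
  rewrite (nth_map q) ?szs // n0 // -mem_enum eS inE mem_nth ?szs ?orbT //.
rewrite sqrtr_sqr.
have -> : `|\det (hom_mx [:: pt q, pt q + n & [seq pt v | v <- s]])| =
    `|\det (hom_mx (pt q + n :: [seq pt v | v <- enum (S p)]))|.
  apply: normr_det_hom_mx_perm; first by rewrite /= size_map szs prednK.
  rewrite eS /= -(cat1s (pt q)) -(cat1s (pt q + n)) perm_catCA.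
  by [].
rewrite normr_det_hom_mx_cons // dotDr addrA.
have qT : q \in T by move: qS; rewrite !inE => /andP[].
have qp : (p == q) = false by move: qS; rewrite !inE eq_sym => /andP[/negPf].
rewrite (barycentric_coord bT) // qp add0r nG dotZr.
have G0 : 0 < Num.sqrt (dot (G p) (G p)) by rewrite sqrtr_gt0 dot_grad_gt0.
move: (sqr_sqrtr (dot_ge0 (G p))) G0; set r := Num.sqrt _ => <- r0.
rewrite mulNr normrN expr2 mulKf ?gt_eqF // gtr0_norm // vol_simplex.
rewrite mulrC -[in d`!](prednK d_gt0) factS prednK // natrM.
have : (d.-1)`!%:R != 0 :> R by rewrite pnatr_eq0 -lt0n fact_gt0.
have : d%:R != 0 :> R by rewrite pnatr_eq0 -lt0n.
by move: D r {r0} d%:R (_`!%:R) => a b e h e0 h0; field; rewrite e0 h0.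
Qed.

Lemma vol_face_gt0 p : p \in T -> 0 < vol (S p).
Proof.
move=> pT; rewrite vol_face // mulr_gt0 ?sqrtr_gt0 ?dot_grad_gt0 //.
by apply: mulr_gt0; [rewrite ltr0n | exact: vol_simplex_gt0].
Qed.

(** The square roots of the normal and of the side measure cancel; integration by parts uses normals
    only in this combination. *)
Lemma vol_outer_normal p : p \in T ->
  vol (S p) *: outer_normal T (S p) = - (d%:R * vol T) *: G p.
Proof.
move=> pT; rewrite vol_face // outer_normal_grad // scalerA; congr (_ *: _).
by rewrite mulrN mulfK // gt_eqF // sqrtr_gt0 dot_grad_gt0.
Qed.

End Simplex.

(** * Green's formula on one element *)

Section SimplexGreen.
Context {R : realType} {d : nat} {M : mesh R d}.
Local Notation V := (vert M).
Local Notation P := ('rV[R]_d).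
Variables (T : {set V}) (c : V -> R) (G : V -> P).
Hypotheses (d_gt0 : (0 < d)%N) (cT : #|T| = d.+1) (bT : barycentric T c G).

Let S p : {set V} := (T :\ p)%SET.

Lemma vertex_hull (A : {set V}) v : v \in A -> hull A (pt v).
Proof.
move=> vA; exists (fun w => (w == v)%:R); split.
- by move=> w _; rewrite ler0n.
- by rewrite (bigD1 v) //= eqxx big1 ?addr0 // => w /andP[_ /negPf->].
- rewrite (bigD1 v) //= eqxx scale1r big1 ?addr0 // => w /andP[_ /negPf->].
  by rewrite scale0r.
Qed.

Lemma sum_grad0 (y : P) : \sum_(p in T) dot y (G p) = 0.
Proof. by rewrite -dot_sumr; case: bT => _ _ -> _ _; rewrite dot0r. Qed.

Lemma sum_dot_grad (y : P) : \sum_(p in T) dot y (G p) *: pt p = y.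
Proof.
rewrite -[RHS](barycentric_repr bT); case: bT => _ _ _ c0 _.
under [in RHS]eq_bigr do rewrite scalerDl dotC.
by rewrite big_split /= c0 add0r.
Qed.

(** Both sides are the divergence of x B: the right one after writing this field as its barycentric
    interpolant at the vertices. *)
Lemma mxtrace_grad (B : 'M[R]_d) : \tr B = \sum_(p in T) dot (pt p *m B) (G p).
Proof.
case: bT => _ _ _ _ GP.
under eq_bigr => p _ do rewrite /dot.
rewrite exchange_big /=; apply: eq_bigr => k _.
under eq_bigr => p do rewrite mxE mulr_suml.
rewrite exchange_big /= (bigD1 k) //= [X in _ + X]big1 ?addr0.
  under eq_bigr => p do rewrite mulrAC mulrC (mulrC (pt _ _ _)).
  by rewrite -mulr_sumr GP eqxx mulr1.
move=> i ik; under eq_bigr => p do rewrite mulrAC mulrC (mulrC (pt _ _ _)).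
by rewrite -mulr_sumr GP eq_sym (negPf ik) mulr0.
Qed.

Let dR_neq0 : d%:R != 0 :> R. Proof. by rewrite pnatr_eq0 -lt0n. Qed.
Let dR1_neq0 : d%:R + 1 != 0 :> R. Proof. by rewrite natr1 pnatr_eq0. Qed.

Lemma sum_vertices : \sum_(p in T) pt p = (d%:R + 1) *: bary T.
Proof. by rewrite /bary cT scalerA natr1 mulfV ?scale1r // pnatr_eq0. Qed.

Lemma bary_face p : p \in T -> bary (S p) = bary T - d%:R^-1 *: (pt p - bary T).
Proof.
move=> pT; rewrite {1}/bary card_face //.
move: (bary T) sum_vertices => xT sT; apply: (scalerI dR_neq0).
rewrite scalerBr !scalerA mulfV // !scale1r opprB addrA.
have -> : d%:R *: xT + xT = \sum_(p in T) pt p.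
  by rewrite sT scalerDl scale1r.
by rewrite [in RHS](big_setD1 p) //= addrAC subrr add0r.
Qed.

(* The Raviart-Thomas condition makes [dot ((pt p - bary T) *m B) (G p)]
   independent of p ([kap] below), so that the terms quadratic in the
   [pt p - bary T] cancel. *)
Lemma simplex_green (a : R) (b y0 : P) (B : 'M[R]_d) :
  (forall p, p \in T -> exists k, forall x, hull (S p) x ->
    dot (y0 + x *m B) (outer_normal T (S p)) = k) ->
  vol T * (dot b (y0 + bary T *m B) + (a + dot b (bary T)) * \tr B) =
  \sum_(p in T) vol (S p) * ((a + dot b (bary (S p))) *
     dot (y0 + bary (S p) *m B) (outer_normal T (S p))).
Proof.
move=> yn; pose m_ (j p : V) := dot (pt j *m B) (G p).
(* The normal of the side opposite to p is a multiple of [G p], so constancy of the normal component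
   makes [m_ j p] the same at all vertices j of that side. *)
have [m mE] : exists m : V -> R, forall p, p \in T -> forall j, j \in S p -> m_ j p = m p.
  suff : forall p, exists mp, p \in T -> forall j, j \in S p -> m_ j p = mp.
    by move=> h; have [m hm] := choice h; exists m.
  move=> p; case: (boolP (p \in T)) => [pT|]; last by exists 0.
  have [k kE] := yn p pT.
  have G0 : 0 < Num.sqrt (dot (G p) (G p)) by rewrite sqrtr_gt0 (dot_grad_gt0 d_gt0 cT bT).
  exists (- (Num.sqrt (dot (G p) (G p))) * k - dot y0 (G p)) => _ j jS.
  rewrite -(kE _ (vertex_hull jS)) (outer_normal_grad d_gt0 cT bT pT) dotZr mulrA.
  by rewrite mulrNN mulfV ?gt_eqF // mul1r dotDl addrC addKr.
(* Since the gradients sum to zero, [m_ p p] is minus the sum of the [m i] over i <> p, so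
   [m_ p p - m p] does not depend on p; passing from pt p to pt p - bary T scales this difference by
   d / (d+1). *)
pose kap := - (d%:R / (d%:R + 1)) * \sum_(p in T) m p.
have kapE p : p \in T -> dot ((pt p - bary T) *m B) (G p) = kap.
  move=> pT; have diag : m_ p p - m p = - \sum_(i in T) m i.
    have := sum_grad0 (pt p *m B); rewrite (big_setD1 p) //=.
    rewrite (eq_bigr m) => [/eqP|i]; last first.
      by rewrite !inE => /andP[ip iT]; apply: mE; rewrite // !inE eq_sym ip.
    rewrite addr_eq0 -/(m_ p p) => /eqP ->.
    by rewrite [in RHS](big_setD1 p) //= opprD addrC.
  rewrite mulmxBl dotBl -/(m_ p p).
  have -> : dot (bary T *m B) (G p) = (d%:R + 1)^-1 * (m_ p p + d%:R * m p).
    rewrite /bary cT natr1 -scalemxAl dotZl mulmx_suml dot_suml; congr (_ * _).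
    rewrite (big_setD1 p) //= (eq_bigr (fun=> m p)) => [|j]; last exact: mE.
    by rewrite sumr_const -[_ *+ _]mulr_natl -/(S p) card_face.
  rewrite /kap mulNr -mulrN -diag; field.
  by rewrite dR1_neq0.
have -> : \tr B = (d%:R + 1) * kap.
  rewrite mxtrace_grad -[LHS]subr0 -[X in _ - X](sum_grad0 (bary T *m B)) -sumrB.
  rewrite (eq_bigr (fun=> kap)) => [|p pT].
    by rewrite sumr_const cT -[LHS]mulr_natl natr1.
  by rewrite -dotBl -mulmxBl kapE.
set vT := a + _; set yT := y0 + _.
(* With both factors expanded about the barycenter of T, the sums of dot b (pt p - bary T) and of
   dot yT (G p) vanish; what survives is their product sum, dot b yT, and the constant term, which
   carries the trace. *)
transitivity (\sum_(p in T) - (d%:R * vol T) *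
   ((vT - d%:R^-1 * dot b (pt p - bary T)) * (dot yT (G p) - d%:R^-1 * kap))).
  have -> : dot b yT = \sum_(p in T) dot b (pt p - bary T) * dot yT (G p).
    under eq_bigr => p _ do rewrite dotBr mulrBl.
    rewrite sumrB -mulr_sumr sum_grad0 mulr0 subr0.
    rewrite -[X in dot b X](sum_dot_grad yT) dot_sumr.
    by apply: eq_bigr => p _; rewrite dotZr mulrC.
  have q0 : \sum_(p in T) dot b (pt p - bary T) = 0.
    rewrite -dot_sumr sumrB sum_vertices sumr_const cT -[X in _ - X]scaler_nat natr1.
    by rewrite subrr dot0r.
  have g0 := sum_grad0 yT.
  rewrite -mulr_sumr.
  under [in RHS]eq_bigr => p _.
    have -> : (vT - d%:R^-1 * dot b (pt p - bary T)) * (dot yT (G p) - d%:R^-1 * kap) =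
      (vT * dot yT (G p) + (d%:R^-1 * d%:R^-1 * kap) * dot b (pt p - bary T)) +
      (- d%:R^-1 * (dot b (pt p - bary T) * dot yT (G p)) - vT * d%:R^-1 * kap) by ring.
    over.
  rewrite !big_split /= -!mulr_sumr g0 q0 !mulr0 !add0r sumr_const cT.
  rewrite -[_ *+ d.+1]mulr_natl -natr1.
  by move: (\sum_(p in T) _) => X; field.
apply: eq_bigr => p pT; rewrite [RHS]mulrCA -(dotZr _ (vol _)).
rewrite (vol_outer_normal d_gt0 cT bT pT) (dotZr _ (- _)).
rewrite [RHS]mulrCA bary_face //; congr (_ * (_ * _)).
  by rewrite [in RHS]dotBr (dotZr _ d%:R^-1) addrA.
by rewrite mulmxBl addrA dotBl -(scalemxAl d%:R^-1) (dotZl d%:R^-1) kapE.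
Qed.

End SimplexGreen.

(** * Elements that share a side *)

Section MeshGeometry.
Context {R : realType} {d : nat} {M : mesh R d}.
Local Notation V := (vert M).
Local Notation P := ('rV[R]_d).
Hypothesis d_gt0 : (0 < d)%N.
Hypothesis M_simplex : forall T, T \in elems M -> #|T| = d.+1 /\ affinely_independent T.
Hypothesis M_conform : forall T T', T \in elems M -> T' \in elems M ->
  hull T `&` hull T' = hull (T :&: T').
Implicit Types (S T : {set V}).

Lemma elem_card T : T \in elems M -> #|T| = d.+1.
Proof. by case/M_simplex. Qed.

Lemma elem_barycentric T : T \in elems M -> exists c G, barycentric T c G.
Proof. by move=> /M_simplex[]; exact: barycentric_exists. Qed.

Lemma affine_comb (A : {set V}) (w : V -> R) (a : R) (b : P) :
  \sum_(v in A) w v = 1 ->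
  a + dot b (\sum_(v in A) w v *: pt v) = \sum_(v in A) w v * (a + dot b (pt v)).
Proof.
move=> w1; under [RHS]eq_bigr do rewrite mulrDr -dotZr.
by rewrite big_split /= -mulr_suml w1 mul1r dot_sumr.
Qed.

Lemma side_faceP T S : T \in elems M -> S \subset T -> #|S| = d ->
  exists2 p, p \in T & S = (T :\ p)%SET.
Proof.
move=> TM ST cS; have : #|(T :\: S)%SET| == 1%N.
  by rewrite cardsDS // cS elem_card // subSnn.
move=> /cards1P[p TS]; have : p \in (T :\: S)%SET by rewrite TS set11.
rewrite inE => /andP[pS pT]; exists p => //; apply/eqP.
rewrite eqEcard cS (card_face (elem_card TM)) // leqnn andbT.
by rewrite subsetD1 ST pS.
Qed.

Lemma face_side T p : T \in elems M -> p \in T -> is_side_of (T :\ p)%SET T.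
Proof.
by move=> TM pT; rewrite /is_side_of (card_face (elem_card TM)) // eqxx subD1set.
Qed.

(** Distinct elements have equally many vertices, so their intersection is proper, has at most d
    vertices, and cannot exceed S. *)
Lemma elem_setI T T' S : T \in elems M -> T' \in elems M -> T != T' ->
  S \subset T -> S \subset T' -> #|S| = d -> T :&: T' = S.
Proof.
move=> TM TM' TT' ST ST' cS; apply/esym/eqP.
rewrite eqEcard finset.subsetI ST ST' cS /= -ltnS -(elem_card TM).
apply: proper_card; rewrite properE finset.subsetIl /=.
apply: contra TT'; rewrite finset.subsetI subxx /= => TT'.
by rewrite eqEcard TT' !elem_card /=.
Qed.

(* Otherwise a point on the segment from the barycenter of the common face to
   pt p', close to the face, lies in both elements but not on the face. *)
Lemma opposite_sides T T' p p' c (G : V -> P) :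
  T \in elems M -> T' \in elems M -> T != T' -> p \in T -> p' \in T' ->
  (T :\ p = T' :\ p')%SET -> barycentric T c G -> c p + dot (G p) (pt p') < 0.
Proof.
move=> TM TM' TT' pT pT' SE bT; rewrite ltNge; apply/negP => lp.
set S := (T :\ p)%SET in SE *; have cS : #|S| = d by rewrite card_face ?elem_card.
have ST v : v \in S -> v \in T by rewrite !inE => /andP[].
have ST' v : v \in S -> v \in T' by rewrite SE !inE => /andP[].
have II : T :&: T' = S.
  by apply: elem_setI; rewrite ?cS // ?SE ?subD1set // -SE subD1set.
pose l v x := c v + dot (G v) x.
have dR : 0 < d%:R :> R by rewrite ltr0n.
pose K := \sum_(v in S) `|l v (pt p')|.
have K0 : 0 <= K by apply: sumr_ge0.
(* This value solves (1 - e) / d = e K: the weight of each face vertex then just outweighs any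
   negative coordinate of pt p', scaled by e. *)
pose e := (1 + d%:R * K)^-1.
have den : 0 < 1 + d%:R * K by rewrite ltr_pwDl // mulr_ge0 // ltW.
have e0 : 0 < e by rewrite invr_gt0.
pose w v := if v == p' then e else (1 - e) / d%:R.
have wS v : v \in S -> w v = (1 - e) / d%:R.
  by rewrite SE !inE /w => /andP[/negPf->].
have e1 : 0 <= 1 - e.
  by rewrite subr_ge0 invf_le1 // lerDl mulr_ge0 // ltW.
have wT' (W : nmodType) (F : V -> W) : \sum_(v in T') F v = F p' + \sum_(v in S) F v.
  by rewrite (big_setD1 p') //= -SE.
have w1 : \sum_(v in T') w v = 1.
  rewrite wT' (eq_bigr (fun=> (1 - e) / d%:R)) // sumr_const cS /w eqxx.
  by rewrite -[_ *+ d]mulr_natr divfK ?gt_eqF // addrC subrK.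
pose x := \sum_(v in T') w v *: pt v.
have lx v : v \in T -> l v x = e * l v (pt p') + (v != p)%:R * ((1 - e) / d%:R).
  move=> vT; rewrite /l affine_comb // wT' {1}/w eqxx; congr (_ + _).
  have [->|vp] := eqVneq v p.
    rewrite big1 ?mul0r // => q qS; rewrite (barycentric_coord bT pT (ST _ qS)).
    by move: qS; rewrite !inE eq_sym => /andP[/negPf-> _]; rewrite mulr0.
  rewrite -[(~~ _)%:R]/1 mul1r (bigD1 v) ?inE ?vp //= (barycentric_coord bT) // eqxx mulr1.
  rewrite wS ?inE ?vp // big1 ?addr0 // => q /andP[qS qv].
  by rewrite (barycentric_coord bT vT (ST _ qS)) eq_sym (negPf qv) mulr0.
have xT : hull T x.
  exists (fun v => l v x); split.
  - move=> v vT; rewrite lx //; have [->|vp] := eqVneq v p.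
      by rewrite mul0r addr0 mulr_ge0 // ltW.
    rewrite -[(~~ _)%:R]/1 mul1r -lerBlDl sub0r.
    have lK : `|l v (pt p')| <= K.
      rewrite /K (bigD1 v) ?inE ?vp //= lerDl; exact: sumr_ge0.
    have -> : (1 - e) / d%:R = e * K.
      rewrite /e; field; rewrite ?gt_eqF //.
    rewrite -mulrN ler_pM2l //; apply: le_trans lK.
    by rewrite -normrN ler_norm.
  - exact: barycentric_sum1 bT x.
  - by rewrite (barycentric_repr bT).
have xT' : hull T' x.
  exists w; split=> // v vT'; rewrite /w; case: ifP => _; first exact: ltW.
  by rewrite divr_ge0 // ltW.
have : (hull T `&` hull T') x by [].
rewrite M_conform // II => -[u [u0 u1 xu]].
(* The contradiction: the coordinate of p' in T' vanishes on the hull of the common face, but equals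
   e > 0 at x. *)
have [c' [G' bT']] := elem_barycentric TM'.
have : c' p' + dot (G' p') x = 0.
  rewrite xu affine_comb // big1 // => v vS.
  rewrite (barycentric_coord bT' pT' (ST' _ vS)).
  by move: vS; rewrite SE !inE eq_sym => /andP[/negPf-> _]; rewrite mulr0.
rewrite /x affine_comb // wT' (barycentric_coord bT') // /w !eqxx mulr1 big1.
  by rewrite addr0 => /eqP; rewrite gt_eqF.
move=> v vS; rewrite (barycentric_coord bT' pT' (ST' _ vS)).
by move: vS; rewrite SE !inE eq_sym => /andP[/negPf-> _]; rewrite mulr0.
Qed.

(** A hyperplane has only two sides. The coordinate of p2 in T2 is affine and zero on S, so its
    value at p3 is its value at p1 times the coordinate of p1 in T1 at p3. For three distinct
    elements all three numbers would be negative. *)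
Lemma elem_sharing_side T1 T2 T3 S :
  T1 \in elems M -> T2 \in elems M -> T3 \in elems M -> T1 != T2 ->
  S \subset T1 -> S \subset T2 -> S \subset T3 -> #|S| = d ->
  T3 = T1 \/ T3 = T2.
Proof.
move=> T1M T2M T3M T12 S1 S2 S3 cS.
have [|T31] := eqVneq T3 T1; first by left.
have [|T32] := eqVneq T3 T2; first by right.
have [p1 p1T S1E] := side_faceP T1M S1 cS.
have [p2 p2T S2E] := side_faceP T2M S2 cS.
have [p3 p3T S3E] := side_faceP T3M S3 cS.
have [c1 [G1 b1]] := elem_barycentric T1M.
have [c2 [G2 b2]] := elem_barycentric T2M.
have T21 : T2 != T1 by rewrite eq_sym.
have T13 : T1 != T3 by rewrite eq_sym.
have T23 : T2 != T3 by rewrite eq_sym.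
have n13 := opposite_sides T1M T3M T13 p1T p3T (etrans (esym S1E) S3E) b1.
have n21 := opposite_sides T2M T1M T21 p2T p1T (etrans (esym S2E) S1E) b2.
have n23 := opposite_sides T2M T3M T23 p2T p3T (etrans (esym S2E) S3E) b2.
have : c2 p2 + dot (G2 p2) (pt p3) = (c1 p1 + dot (G1 p1) (pt p3)) * (c2 p2 + dot (G2 p2) (pt p1)).
  rewrite (affine_barycentric b1) (big_setD1 p1) //= -S1E [X in _ + X]big1 ?addr0 // => v.
  rewrite S2E !inE => /andP[vp vT].
  by rewrite (barycentric_coord b2) // eq_sym (negPf vp) mulr0.
move=> E; move: n23; rewrite E => /lt_geF.
by rewrite mulr_le0 // ltW.
Qed.

Lemma hull_normal T p (v : V) x : T \in elems M -> p \in T ->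
  v \in (T :\ p)%SET -> hull (T :\ p)%SET x ->
  dot (outer_normal T (T :\ p)%SET) x = dot (outer_normal T (T :\ p)%SET) (pt v).
Proof.
move=> TM pT vS [w [_ w1 ->]]; have [c [G bT]] := elem_barycentric TM.
have [_ n0 _] := outer_normalP d_gt0 (elem_card TM) bT pT.
rewrite -[RHS]mul1r -w1 mulr_suml dot_sumr; apply: eq_bigr => u uS.
rewrite dotZr; congr (_ * _); apply/eqP; rewrite -subr_eq0 -dotBr.
by rewrite n0.
Qed.

(* On an element T with opposite vertex p to S, the Raviart-Thomas basis
   function is a multiple of [x - pt p], tangential to the sides through p. *)
Lemma flux_basis S (sigma : {set V} -> R) : #|S| = d ->
  exists2 y : vfield M, pw_vpoly 1 y &
    forall T S', T \in elems M -> is_side_of S' T -> forall x, hull S' x ->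
      dot (y T x) (outer_normal T S') = (S' == S)%:R * sigma T.
Proof.
move=> cS; suff : forall T, exists yT : P -> P, T \in elems M ->
    (forall i, polynomial_fun 1 (fun x => yT x 0 i)) /\
    forall S', is_side_of S' T -> forall x, hull S' x ->
      dot (yT x) (outer_normal T S') = (S' == S)%:R * sigma T.
  move=> /choice[y yE]; exists y => [i T TM|T S' TM]; first by case: (yE T TM).
  by case: (yE T TM) => _ /(_ S').
move=> T; case: (boolP (T \in elems M)) => [TM|]; last by exists (fun=> 0).
have [ST|ST] := boolP (S \subset T); last first.
  exists (fun=> 0) => _; split=> [i|S' /andP[_ S'T] x _].
    by apply/polynomial_fun1P; exists 0, 0 => x; rewrite mxE dot0l addr0.
  rewrite dot0l; case: eqP => [SE|]; last by rewrite mul0r.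
  by rewrite -SE S'T in ST.
have [p pT SE] := side_faceP TM ST cS.
have [c [G bT]] := elem_barycentric TM.
have [q qS qT] := face_neq0 d_gt0 (elem_card TM) pT.
have [_ n0 n1] := outer_normalP d_gt0 (elem_card TM) bT pT.
have pS : p \notin (T :\ p)%SET by rewrite !inE eqxx.
have h0 := n1 q p qS pT pS; rewrite -SE in n0 n1 h0.
set n := outer_normal T S in n0 n1 h0.
(* For x in S, dot n (x - pt p) equals - dot n (pt p - pt q), so the flux through S is [sigma T]. *)
pose k := - sigma T / dot n (pt p - pt q).
exists (fun x => k *: (x - pt p)) => _; split.
  move=> i; apply/polynomial_fun1P; exists (- (k * pt p 0 i)), (k *: delta_mx 0 i) => x.
  rewrite !mxE mulrBr addrC dotZl; congr (_ + k * _).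
  rewrite /dot (bigD1 i) //= mxE !eqxx mul1r big1 ?addr0 // => j /negPf ji.
  by rewrite mxE ji andbF mul0r.
move=> S' /andP[/eqP cS' S'T] x xS'; have [p' p'T S'E] := side_faceP TM S'T cS'.
rewrite dotZl dotC; have [S'S|S'S] := eqVneq S' S.
  rewrite S'S -/n dotBr; have -> : dot n x = dot n (pt q).
    by rewrite /n SE; apply: hull_normal; rewrite // -SE -S'S.
  rewrite mul1r -dotBr -opprB dotNr /k mulrN divfK ?opprK // lt_eqF //.
rewrite mul0r dotBr S'E (@hull_normal T p' p) // -?S'E // ?subrr ?mulr0 //.
rewrite S'E !inE pT andbT; apply: contra S'S => /eqP pp'.
by rewrite S'E SE pp'.
Qed.

End MeshGeometry.

(** * Green's formula on the mesh *)

Section MeshGreen.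
Context {R : realType} {d : nat} {M : mesh R d}.
Local Notation V := (vert M).
Local Notation P := ('rV[R]_d).
Hypothesis d_gt0 : (0 < d)%N.
Hypothesis M_simplex : forall T, T \in elems M -> #|T| = d.+1 /\ affinely_independent T.
Hypothesis M_conform : forall T T', T \in elems M -> T' \in elems M ->
  hull T `&` hull T' = hull (T :&: T').
Implicit Types (A S T : {set V}) (u v : sfield M) (y z : vfield M).

Let elem_card := elem_card M_simplex.

Lemma sideP S : S \in sides M -> #|S| = d /\ exists2 T, T \in elems M & S \subset T.
Proof. by rewrite inE => /andP[/eqP cS /existsP[T /andP[TM ST]]]; split=> //; exists T. Qed.

Lemma int_sideP S : S \in int_sides M ->
  S \in sides M /\ exists T1 T2, [/\ T1 \in elems M, T2 \in elems M,
    T1 != T2, S \subset T1 & S \subset T2].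
Proof.
rewrite inE => /andP[SM /existsP[T1 /andP[T1M /existsP[T2 /and3P[T2M T12 /eqP SE]]]]].
by split=> //; exists T1, T2; split; rewrite // SE ?finset.subsetIl ?finset.subsetIr.
Qed.

Lemma bdry_side S : S \in bdry_sides M -> S \in sides M.
Proof. by rewrite inE => /andP[]. Qed.

(** A second element containing S would meet the first exactly in S and make S an interior side. *)
Lemma bdry_side_adj S : S \in bdry_sides M ->
  [/\ adj S \in elems M, S \subset adj S &
      forall T, T \in elems M -> S \subset T -> T = adj S].
Proof.
move=> Sb; have [cS [T0 T0M ST0]] := sideP (bdry_side Sb).
have [aM aS] : adj S \in elems M /\ S \subset adj S.
  rewrite /adj; case: pickP => [T /andP[]//|/(_ T0)]; by rewrite T0M ST0.
split=> // T TM ST; apply/eqP; move: Sb; rewrite inE => /andP[+ SM].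
apply: contraNT => Tadj; rewrite inE SM; apply/existsP; exists T; rewrite TM.
apply/existsP; exists (adj S); rewrite aM Tadj; apply/eqP/esym.
exact: (elem_setI M_simplex).
Qed.

Lemma elem_vol_gt0 T : T \in elems M -> 0 < vol T.
Proof.
move=> TM; have [c [G bT]] := elem_barycentric M_simplex TM.
exact: vol_simplex_gt0 (elem_card TM) bT.
Qed.

Lemma side_vol_gt0 S : S \in sides M -> 0 < vol S.
Proof.
move=> /sideP[cS [T TM ST]]; have [c [G bT]] := elem_barycentric M_simplex TM.
have [p pT ->] := side_faceP M_simplex TM ST cS.
by have := vol_face_gt0 d_gt0 (elem_card TM) bT pT.
Qed.

Lemma elem_card_gt0 T : T \in elems M -> (0 < #|T|)%N.
Proof. by move=> /elem_card ->. Qed.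

Lemma side_card_gt0 S : S \in sides M -> (0 < #|S|)%N.
Proof. by move=> /sideP[-> _]. Qed.

Lemma mesh_int_const (B : {set {set V}}) (f : sfield M) :
  (forall A, A \in B -> (0 < #|A|)%N) ->
  on_sides B (fun A x => f A x = f A (bary A)) ->
  mesh_int B f = \sum_(A in B) vol A * f A (bary A).
Proof.
move=> B0 fB; apply: eq_bigr => A AB.
rewrite (@int_simplex_affine _ _ _ _ _ (f A (bary A)) 0) ?B0 // ?dot0l ?addr0 //.
by move=> x xA; rewrite dot0l addr0 fB.
Qed.

Lemma mean_affine A (p : P -> R) : (0 < #|A|)%N -> 0 < vol A ->
  polynomial_fun 1 p -> mean A p = p (bary A).
Proof.
move=> A0 vA /polynomial_fun1P[a [b pE]]; rewrite /mean.
rewrite (@int_simplex_affine _ _ _ _ _ a b) // (@int_simplex_affine _ _ _ _ _ 1 0) //.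
  by rewrite dot0l addr0 mulr1 mulrAC mulfV ?gt_eqF // mul1r -pE.
by move=> x _; rewrite dot0l addr0.
Qed.

Lemma vector_affine y T : pw_vpoly 1 y -> T \in elems M ->
  exists (y0 : P) (B : 'M[R]_d), forall x, y T x = y0 + x *m B.
Proof.
move=> y1 TM; have : forall i, exists ab : R * P, forall x, y T x 0 i = ab.1 + dot ab.2 x.
  by move=> i; have /polynomial_fun1P[a [b abE]] := y1 i T TM; exists (a, b).
move=> /choice[ab abE]; exists (\row_i (ab i).1), (\matrix_(j, i) (ab i).2 0 j) => x.
apply/rowP => i; rewrite abE !mxE; congr (_ + _).
by apply: eq_bigr => j _; rewrite !mxE mulrC.
Qed.

Lemma Pi_hE v T x : pw_poly 1 v -> T \in elems M -> Pi_h v T x = v T (bary T).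
Proof.
by move=> v1 TM; rewrite /Pi_h mean_affine ?elem_card_gt0 ?elem_vol_gt0 //; exact: v1.
Qed.

Lemma vPi_hE y T x : pw_vpoly 1 y -> T \in elems M -> vPi_h y T x = y T (bary T).
Proof.
move=> y1 TM; apply/rowP => i; rewrite mxE mean_affine ?elem_card_gt0 ?elem_vol_gt0 //.
exact: y1.
Qed.

Lemma side_meanE v S x : pw_poly 1 v -> S \in bdry_sides M ->
  side_mean v S x = v (adj S) (bary S).
Proof.
move=> v1 Sb; have [aM _ _] := bdry_side_adj Sb; have SM := bdry_side Sb.
by rewrite /side_mean /Pi_h mean_affine ?side_card_gt0 ?side_vol_gt0 //; exact: v1.
Qed.

Lemma grad_hE v T x (a : R) (b : P) : (forall x, v T x = a + dot b x) ->
  grad_h v T x = b.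
Proof. by move=> vE; apply/rowP => i; rewrite mxE (derive_affine _ _ vE). Qed.

Lemma div_hE y T x (y0 : P) B : (forall x, y T x = y0 + x *m B) ->
  div_h y T x = \tr B.
Proof.
move=> yE; apply: eq_bigr => i _.
rewrite (@derive_affine _ _ _ (y0 0 i) (\row_j B j i)) ?mxE // => x'.
by rewrite yE !mxE; congr (_ + _); apply: eq_bigr => j _; rewrite !mxE mulrC.
Qed.

Lemma ntrace_const y S x : RT y -> S \in bdry_sides M -> hull S x ->
  ntrace y S x = ntrace y S (bary S).
Proof.
move=> [_ yn _] Sb xS; have [aM aS _] := bdry_side_adj Sb.
have SM := bdry_side Sb; have [cS _] := sideP SM.
have [|k kE] := yn (adj S) S aM; first by rewrite /is_side_of cS eqxx.
by rewrite /ntrace !kE //; apply: bary_hull; exact: side_card_gt0.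
Qed.

Lemma sum_faces T (F : {set V} -> R) : T \in elems M ->
  \sum_(p in T) F (T :\ p)%SET = \sum_(S | is_side_of S T) F S.
Proof.
move=> TM; rewrite -(@big_imset _ _ _ _ _ (fun p => T :\ p)%SET (mem T) F) /=.
  apply: eq_bigl => S; apply/imsetP/idP => [[p pT ->]|/andP[/eqP cS ST]].
    exact: (face_side M_simplex).
  exact: (side_faceP M_simplex).
move=> p q pT qT; apply: contraPP => /eqP pq /setP/(_ p).
by rewrite !inE eqxx pT pq.
Qed.

(** The interior contribution of S to Green's formula. It has to be carried along as long as v is
    not known to have continuous side means. *)
Definition int_flux v y S : R :=
  \sum_(T in elems M | S \subset T) v T (bary S) * dot (y T (bary S)) (outer_normal T S).

Lemma green v y : pw_poly 1 v -> RT y ->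
  vinner (elems M) (grad_h v) (vPi_h y) + inner (elems M) (Pi_h v) (div_h y) =
  \sum_(S in bdry_sides M) vol S * (v (adj S) (bary S) * ntrace y S (bary S)) +
  \sum_(S in int_sides M) vol S * int_flux v y S.
Proof.
move=> v1 [y1 yn yj].
transitivity (\sum_(T in elems M) \sum_(S in sides M | S \subset T)
    vol S * (v T (bary S) * dot (y T (bary S)) (outer_normal T S))).
  rewrite /vinner /inner /mesh_int -big_split; apply: eq_bigr => T TM /=.
  have /polynomial_fun1P[a [b vE]] := v1 T TM.
  have [y0 [B yE]] := vector_affine y1 TM.
  have [c [G bT]] := elem_barycentric M_simplex TM.
  transitivity (vol T * (dot b (y0 + bary T *m B) + (a + dot b (bary T)) * \tr B)).
    rewrite mulrDr; congr (_ + _).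
      rewrite (@int_simplex_affine _ _ _ _ _ (dot b (y0 + bary T *m B)) 0) ?elem_card_gt0 //.
        by rewrite dot0l addr0.
      by move=> x _; rewrite dot0l addr0 (grad_hE _ vE) vPi_hE // yE.
    rewrite (@int_simplex_affine _ _ _ _ _ ((a + dot b (bary T)) * \tr B) 0) ?elem_card_gt0 //.
      by rewrite dot0l addr0.
    by move=> x _; rewrite dot0l addr0 Pi_hE // (div_hE _ yE) vE.
  rewrite (simplex_green d_gt0 (elem_card TM) bT) => [|p pT]; last first.
    have [k kE] := yn T (T :\ p)%SET TM (face_side M_simplex TM pT).
    by exists k => x /kE; rewrite yE.
  rewrite (sum_faces (fun S => vol S * ((a + dot b (bary S)) *
     dot (y0 + bary S *m B) (outer_normal T S)))) //.
  apply: eq_big => [S|S _]; last by rewrite vE yE.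
  rewrite inE /is_side_of; case: (_ == d) => //=.
  case ST: (S \subset T); rewrite ?andbF // andbT; apply/esym/existsP; exists T.
  by rewrite TM.
(* Regrouping by sides leaves one term, that of [adj S], on a boundary side. *)
rewrite (exchange_big_dep (mem (sides M))) /=; last by move=> T S _ /andP[].
rewrite (big_setID (int_sides M)) /= addrC; congr (_ + _).
  apply: eq_bigr => S Sb; have [aM aS aU] := bdry_side_adj Sb.
  rewrite (big_pred1 (adj S)) // => T /=; rewrite bdry_side //=.
  apply/andP/eqP => [[TM ST]|->//]; exact: aU.
rewrite (eq_bigl (mem (int_sides M))) => [|S /=].
  apply: eq_bigr => S Si; rewrite /int_flux mulr_sumr.
  by apply: eq_bigl => T; have [-> _] := int_sideP Si.
by rewrite finset.in_setI; apply: andb_idl => /int_sideP[].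
Qed.

Lemma int_fluxE v y S T1 T2 : S \in sides M -> T1 \in elems M -> T2 \in elems M ->
  T1 != T2 -> S \subset T1 -> S \subset T2 ->
  int_flux v y S = v T1 (bary S) * dot (y T1 (bary S)) (outer_normal T1 S) +
    v T2 (bary S) * dot (y T2 (bary S)) (outer_normal T2 S).
Proof.
move=> SM T1M T2M T12 S1 S2; have [cS _] := sideP SM.
rewrite /int_flux (bigD1 T1) ?T1M //= (bigD1 T2) ?T2M ?S2 1?eq_sym //=.
rewrite big1 ?addr0 // => T /andP[/andP[/andP[TM ST] /eqP T1'] /eqP T2'].
by case: (elem_sharing_side d_gt0 M_simplex M_conform T1M T2M TM T12 S1 S2 ST cS).
Qed.

Lemma mean_jump v S T T' : pw_poly 1 v -> S \in sides M ->
  T \in elems M -> T' \in elems M ->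
  mean S (fun x => v T x - v T' x) = v T (bary S) - v T' (bary S).
Proof.
move=> v1 SM TM T'M; rewrite mean_affine ?side_card_gt0 ?side_vol_gt0 //.
have /polynomial_fun1P[a [b vE]] := v1 T TM.
have /polynomial_fun1P[a' [b' vE']] := v1 T' T'M.
apply/polynomial_fun1P; exists (a - a'), (b - b') => x.
by rewrite vE vE' dotBl opprD addrACA.
Qed.

(** On an interior side both elements give v the same value at the barycenter, and the two outward
    normal components of y add up to zero. *)
Lemma green_CR v y : CR v -> RT y ->
  vinner (elems M) (grad_h v) (vPi_h y) + inner (elems M) (Pi_h v) (div_h y) =
  \sum_(S in bdry_sides M) vol S * (v (adj S) (bary S) * ntrace y S (bary S)).
Proof.
move=> [v1 vj] yRT; rewrite green // [X in _ + X]big1 ?addr0 // => S Si.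
have [SM [T1 [T2 [T1M T2M T12 S1 S2]]]] := int_sideP Si.
rewrite (int_fluxE _ _ SM T1M T2M) //.
have /eqP := vj S T1 T2 Si T1M T2M T12 S1 S2.
rewrite mean_jump // subr_eq0 => /eqP ->.
case: yRT => _ _ yj; rewrite -mulrDr yj ?mulr0 //.
by apply: bary_hull; exact: side_card_gt0.
Qed.

End MeshGreen.

(** * The reconstructed function *)

Section Reconstruction.
Context {R : realType} {d : nat} {M : mesh R d}.
Local Notation V := (vert M).
Local Notation P := ('rV[R]_d).
Hypothesis d_gt0 : (0 < d)%N.
Hypothesis M_simplex : forall T, T \in elems M -> #|T| = d.+1 /\ affinely_independent T.
Implicit Types (A S T : {set V}) (u v w : sfield M) (y z : vfield M).

Lemma reconstructionE (ubar : sfield M) z T x :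
  pw_poly 0 ubar -> pw_vpoly 1 z -> T \in elems M ->
  reconstruction ubar z T x =
    (ubar T 0 - dot (z T (bary T)) (bary T)) + dot (z T (bary T)) x.
Proof.
move=> ub0 z1 TM; rewrite /reconstruction (vPi_hE M_simplex) //.
rewrite (vPi_hE M_simplex) // => [|i T' _]; last first.
  apply/polynomial_fun1P; exists 0, (delta_mx 0 i) => x'.
  rewrite add0r /dot (bigD1 i) //= mxE !eqxx mul1r big1 ?addr0 // => j /negPf ji.
  by rewrite mxE ji andbF mul0r.
have /polynomial_fun0P[k kE] := ub0 T TM.
by rewrite !kE dotBr addrCA addrC.
Qed.

Lemma pw_poly_reconstruction (ubar : sfield M) z :
  pw_poly 0 ubar -> pw_vpoly 1 z -> pw_poly 1 (reconstruction ubar z).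
Proof.
move=> ub0 z1 T TM; apply/polynomial_fun1P.
by eexists; eexists => x; exact: reconstructionE.
Qed.

Lemma grad_h_reconstruction (ubar : sfield M) z T x :
  pw_poly 0 ubar -> pw_vpoly 1 z -> T \in elems M ->
  grad_h (reconstruction ubar z) T x = vPi_h z T x.
Proof.
move=> ub0 z1 TM; rewrite (vPi_hE M_simplex) //.
by apply: grad_hE => x'; exact: reconstructionE.
Qed.

(** The correction is linear in x - bary T and has mean zero. Together with the gradient, this
    identifies the volume terms of the first KKT condition with those of Green's formula. *)
Lemma Pi_h_reconstruction (ubar : sfield M) z T x :
  pw_poly 0 ubar -> pw_vpoly 1 z -> T \in elems M ->
  Pi_h (reconstruction ubar z) T x = ubar T x.
Proof.
move=> ub0 z1 TM; rewrite (Pi_hE M_simplex) //; last exact: pw_poly_reconstruction.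
rewrite reconstructionE // subrK; have /polynomial_fun0P[k kE] := ub0 T TM.
by rewrite !kE.
Qed.

Lemma grad_h_cst v T x : pw_poly 1 v -> T \in elems M -> grad_h v T x = grad_h v T 0.
Proof.
by move=> v1 TM; have /polynomial_fun1P[a [b vE]] := v1 T TM; rewrite !(grad_hE _ vE).
Qed.

Lemma inner_sides (B : {set {set V}}) u v : B \subset sides M ->
  on_sides B (fun S x => u S x = u S (bary S)) ->
  on_sides B (fun S x => v S x = v S (bary S)) ->
  inner B u v = \sum_(S in B) vol S * (u S (bary S) * v S (bary S)).
Proof.
move=> /fintype.subsetP BM uB vB; apply: mesh_int_const => [S /BM|S SB x xS /=].
  exact: side_card_gt0.
by rewrite uB // vB.
Qed.

Lemma side_poly0 (B : {set {set V}}) u : B \subset sides M -> side_poly 0 B u ->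
  on_sides B (fun S x => u S x = u S (bary S)).
Proof.
move=> /fintype.subsetP BM uB S SB x xS; have [p /polynomial_fun0P[k kE] pE] := uB S SB.
by rewrite !pE ?kE //; apply/bary_hull/(side_card_gt0 d_gt0)/BM.
Qed.

Lemma vinner_grad_h w z : pw_poly 1 w -> pw_vpoly 1 z ->
  vinner (elems M) (grad_h w) (vPi_h z) =
  \sum_(T in elems M) vol T * dot (grad_h w T 0) (vPi_h z T 0).
Proof.
move=> w1 z1; rewrite /vinner mesh_int_const => [|T|T TM x xT].
- by apply: eq_bigr => T TM; rewrite !(vPi_hE M_simplex) // !(grad_h_cst _ w1 TM).
- exact: (elem_card_gt0 M_simplex).
- by rewrite !(vPi_hE M_simplex) // !(grad_h_cst _ w1 TM).
Qed.

Lemma vnorm2_grad_h w : pw_poly 1 w ->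
  vnorm2 (elems M) (grad_h w) ^+ 2 =
  \sum_(T in elems M) vol T * dot (grad_h w T 0) (grad_h w T 0).
Proof.
move=> w1; have E : vinner (elems M) (grad_h w) (grad_h w) =
    \sum_(T in elems M) vol T * dot (grad_h w T 0) (grad_h w T 0).
  rewrite /vinner mesh_int_const => [|T|T TM x xT].
  - by apply: eq_bigr => T TM; rewrite !(grad_h_cst _ w1 TM).
  - exact: (elem_card_gt0 M_simplex).
  - by rewrite !(grad_h_cst _ w1 TM).
rewrite /vnorm2 sqr_sqrtr E //; apply: sumr_ge0 => T TM.
by rewrite mulr_ge0 ?dot_ge0 // ltW // (elem_vol_gt0 M_simplex).
Qed.

Lemma RT0 : RT (fun (_ : {set V}) (_ : P) => 0 : P).
Proof.
split.
- by move=> i T TM; apply/polynomial_fun1P; exists 0, 0 => x; rewrite mxE dot0l addr0.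
- by move=> T S TM ST; exists 0 => x _; rewrite dot0l.
- by move=> S T T' *; rewrite !dot0l addr0.
Qed.

End Reconstruction.

(** * Test fields with flux through a single side *)

Section TestFields.
Context {R : realType} {d : nat} {M : mesh R d}.
Local Notation V := (vert M).
Local Notation P := ('rV[R]_d).
Hypothesis d_gt0 : (0 < d)%N.
Hypothesis M_simplex : forall T, T \in elems M -> #|T| = d.+1 /\ affinely_independent T.
Hypothesis M_conform : forall T T', T \in elems M -> T' \in elems M ->
  hull T `&` hull T' = hull (T :&: T').
Implicit Types (A S T : {set V}) (u v w : sfield M) (y z : vfield M).

Lemma side_is_side_of S T : S \in sides M -> S \subset T -> is_side_of S T.
Proof. by move=> /sideP[cS _] ST; rewrite /is_side_of cS eqxx. Qed.

(** The outward flux is 1 from T1 and -1 from T2, which is a vanishing normal jump since no third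
    element contains S. Tested with this field, Green's formula isolates the jump of v across S. *)
Lemma RT_jump_field S T1 T2 : S \in int_sides M ->
  T1 \in elems M -> T2 \in elems M -> T1 != T2 -> S \subset T1 -> S \subset T2 ->
  exists y, [/\ RT y,
    on_sides (bdry_sides M) (fun S' x => ntrace y S' x = 0) &
    forall v, \sum_(S' in int_sides M) vol S' * int_flux v y S' =
      vol S * (v T1 (bary S) - v T2 (bary S))].
Proof.
move=> Si T1M T2M T12 S1 S2; have [SM _] := int_sideP Si; have [cS _] := sideP SM.
pose sigma T : R := (T == T1)%:R - (T == T2)%:R.
have [y y1 yE] := flux_basis d_gt0 M_simplex sigma cS.
exists y; split.
- split=> // [T S' TM S'T|S' T T' S'i TM T'M TT' S'T S'T' x xS'].
    by eexists => x; exact: yE.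
  have [S'M _] := int_sideP S'i.
  rewrite !yE ?side_is_side_of //; have [SS|_] := eqVneq S' S; last by rewrite !mul0r addr0.
  rewrite !mul1r /sigma; rewrite SS in S'T S'T'.
  move: TT'.
  case: (elem_sharing_side d_gt0 M_simplex M_conform T1M T2M TM T12 S1 S2 S'T cS) => ->;
  case: (elem_sharing_side d_gt0 M_simplex M_conform T1M T2M T'M T12 S1 S2 S'T' cS) => ->;
  rewrite !eqxx ?[T2 == T1]eq_sym ?(negPf T12) // => _.
    by rewrite subr0 sub0r subrr.
  by rewrite subr0 sub0r addNr.
- move=> S' S'b x xS'; have [aM aS _] := bdry_side_adj M_simplex S'b.
  rewrite /ntrace yE // ?side_is_side_of ?bdry_side //.
  have -> : (S' == S) = false; last by rewrite mul0r.
  by apply/eqP => SS; move: S'b; rewrite SS inE Si.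
- move=> v; rewrite (bigD1 S) //= big1 ?addr0 => [|S' /andP[S'i S'S]]; last first.
    rewrite /int_flux big1 ?mulr0 // => T /andP[TM S'T]; have [S'M _] := int_sideP S'i.
    rewrite yE ?side_is_side_of //; first by rewrite (negPf S'S) mul0r mulr0.
    by apply: bary_hull; exact: side_card_gt0.
  have bS : hull S (bary S) by apply: bary_hull; exact: side_card_gt0.
  rewrite (int_fluxE d_gt0 M_simplex M_conform _ _ SM T1M T2M) //.
  rewrite !yE ?side_is_side_of // eqxx !mul1r /sigma !eqxx.
  by rewrite [T2 == T1]eq_sym (negPf T12) subr0 sub0r mulr1 mulrN1.
Qed.

(** S is not an interior side, so unit outflow through it creates no normal jump anywhere. *)
Lemma RT_bdry_field S : S \in bdry_sides M ->
  exists y, [/\ RT y,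
    on_sides (bdry_sides M) (fun S' x => ntrace y S' x = (S' == S)%:R) &
    forall v, \sum_(S' in int_sides M) vol S' * int_flux v y S' = 0].
Proof.
move=> Sb; have [cS _] := sideP (bdry_side Sb).
have [y y1 yE] := flux_basis d_gt0 M_simplex (fun=> 1) cS.
have intS S' : S' \in int_sides M -> (S' == S) = false.
  by move=> S'i; apply/eqP => SS; move: Sb; rewrite -SS inE S'i.
exists y; split.
- split=> // [T S' TM S'T|S' T T' S'i TM T'M TT' S'T S'T' x xS'].
    by eexists => x; exact: yE.
  have [S'M _] := int_sideP S'i.
  by rewrite !yE ?side_is_side_of // intS // !mul0r addr0.
- move=> S' S'b x xS'; have [aM aS _] := bdry_side_adj M_simplex S'b.
  by rewrite /ntrace yE // ?side_is_side_of ?bdry_side // mulr1.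
- move=> v; rewrite big1 // => S' S'i; have [S'M _] := int_sideP S'i.
  rewrite /int_flux big1 ?mulr0 // => T /andP[TM S'T].
  rewrite yE ?side_is_side_of //; first by rewrite intS // mul0r mulr0.
  by apply: bary_hull; exact: side_card_gt0.
Qed.

End TestFields.

(** * From the KKT conditions to minimality *)

Section KKT.
Context {R : realType} {d : nat} {M : mesh R d}.
Local Notation V := (vert M).
Local Notation P := ('rV[R]_d).
Hypothesis d_gt0 : (0 < d)%N.
Hypothesis M_simplex : forall T, T \in elems M -> #|T| = d.+1 /\ affinely_independent T.
Hypothesis M_conform : forall T T', T \in elems M -> T' \in elems M ->
  hull T `&` hull T' = hull (T :&: T').
Variables (GI GD GN : set P) (m : R).
Hypothesis M_resolves : resolves M GI GD GN.
Hypothesis m_gt0 : 0 < m.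
Variables (f g uD : sfield M) (z : vfield M) (ubar : sfield M) (mu : R) (lp lm : sfield M).
Hypotheses (g_L0 : side_poly 0 (sides_on M GN) g)
  (uD_L0 : side_poly 0 (sides_on M GD) uD) (z_RT : RT z) (ubar_L0 : pw_poly 0 ubar)
  (lp_L0 : side_poly 0 (sides_on M GI) lp) (lm_L0 : side_poly 0 (sides_on M GI) lm)
  (z_N : on_sides (sides_on M GN) (fun S x => ntrace z S x = g S x)).

Let sI := sides_on M GI.
Let sD := sides_on M GD.
Let sN := sides_on M GN.

Let sub_bdry (G : set P) : sides_on M G \subset bdry_sides M.
Proof. by apply/fintype.subsetP => S; rewrite inE => /andP[]. Qed.

Let sub_sides (G : set P) : sides_on M G \subset sides M.
Proof.
by apply/fintype.subsetP => S /(fintype.subsetP (sub_bdry G)); exact: bdry_side.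
Qed.

Let on_bdry (G : set P) S : S \in sides_on M G -> S \in bdry_sides M.
Proof. exact: (fintype.subsetP (sub_bdry G)). Qed.

Let bary_in (G : set P) S : S \in sides_on M G -> hull S (bary S).
Proof. by move=> /on_bdry /bdry_side SM; apply: bary_hull; exact: side_card_gt0. Qed.

Lemma sum_bdry_sides (F : {set V} -> R) :
  \sum_(S in bdry_sides M) F S =
  \sum_(S in sI) F S + \sum_(S in sD) F S + \sum_(S in sN) F S.
Proof.
have [-> ID IN DN] := M_resolves.
have U (A B : {set {set V}}) : A :&: B = finset.set0 ->
    \sum_(S in A :|: B) F S = \sum_(S in A) F S + \sum_(S in B) F S.
  move=> /eqP; rewrite finset.setI_eq0 => AB; rewrite -bigU //.
  by apply: eq_bigl => S; rewrite finset.in_setU.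
by rewrite !U // finset.setIUl IN DN finset.setU0.
Qed.

Let z1 : pw_vpoly 1 z. Proof. by case: z_RT. Qed.
Let u := reconstruction ubar z.
Let u1 : pw_poly 1 u. Proof. exact: (pw_poly_reconstruction M_simplex). Qed.
Let bd (v : sfield M) S := v (adj S) (bary S).
Let zn S := ntrace z S (bary S).

Let ntrace_on (G : set P) y : RT y ->
  on_sides (sides_on M G) (fun S x => ntrace y S x = ntrace y S (bary S)).
Proof. by move=> yRT S /on_bdry Sb x xS; apply: (ntrace_const d_gt0 M_simplex). Qed.

Hypothesis kkt1 : forall y, RT_N GN y ->
  vinner (elems M) (vPi_h z) (vPi_h y) + inner (elems M) ubar (div_h y)
    + inner sI (fun S x => lp S x - lm S x) (ntrace y) = inner sD uD (ntrace y).

Lemma kkt1_green y : RT_N GN y ->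
  \sum_(S in bdry_sides M) vol S * (bd u S * ntrace y S (bary S))
  + \sum_(S in int_sides M) vol S * int_flux u y S
  + \sum_(S in sI) vol S * ((lp S (bary S) - lm S (bary S)) * ntrace y S (bary S))
  = \sum_(S in sD) vol S * (uD S (bary S) * ntrace y S (bary S)).
Proof.
move=> yRT; have [yR _] := yRT; have := kkt1 yRT.
have -> : vinner (elems M) (vPi_h z) (vPi_h y) = vinner (elems M) (grad_h u) (vPi_h y).
  apply: eq_bigr => T TM; congr (int_simplex T _); apply/funext => x.
  by rewrite (grad_h_reconstruction M_simplex).
have -> : inner (elems M) ubar (div_h y) = inner (elems M) (Pi_h u) (div_h y).
  apply: eq_bigr => T TM; congr (int_simplex T _); apply/funext => x.
  by rewrite (Pi_h_reconstruction M_simplex).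
rewrite (green d_gt0 M_simplex) // !(inner_sides d_gt0 (sub_sides _)) //; try exact: ntrace_on.
- exact: (side_poly0 d_gt0 (sub_sides _) uD_L0).
- move=> S SI x xS;  rewrite (side_poly0 d_gt0 (sub_sides _) lp_L0) //.
  by rewrite (side_poly0 d_gt0 (sub_sides _) lm_L0).
Qed.

(** The jump field has no normal trace on the whole boundary: it is admissible, all boundary sums
    vanish, and only a positive multiple of the jump of [u] remains. *)
Lemma reconstruction_CR : CR u.
Proof.
split=> // S T T' Si TM T'M TT' ST ST'; have [SM _] := int_sideP Si.
rewrite (mean_jump d_gt0 M_simplex) //.
have [y [yRT y0 yint]] := RT_jump_field d_gt0 M_simplex M_conform Si TM T'M TT' ST ST'.
have y0' G S' : S' \in sides_on M G -> ntrace y S' (bary S') = 0.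
  by move=> S'G; apply: y0; [exact: on_bdry S'G|exact: bary_in S'G].
have yN : RT_N GN y by split=> // S' S'N x xS'; apply: y0 => //; exact: on_bdry S'N.
have := kkt1_green yN; rewrite yint sum_bdry_sides.
have s0 G (F : {set V} -> R) :
    \sum_(S in sides_on M G) vol S * (F S * ntrace y S (bary S)) = 0.
  by apply: big1 => S' /y0' ->; rewrite !mulr0.
rewrite !s0 !add0r !addr0 => /eqP.
by rewrite mulf_eq0 gt_eqF ?(side_vol_gt0 d_gt0 M_simplex) //= => /eqP.
Qed.

(** The condition [S \notin sN] is what admits the field with unit outflow through S as a test
    field. The membership factors treat the two other boundary parts at once. *)
Lemma bdry_mean S : S \in sI :|: sD -> S \notin sN ->
  bd u S + (S \in sI)%:R * (lp S (bary S) - lm S (bary S)) = (S \in sD)%:R * uD S (bary S).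
Proof.
move=> SID SN.
have Sb : S \in bdry_sides M by move: SID; rewrite finset.in_setU => /orP[] /on_bdry.
have [y [yRT yE yint]] := RT_bdry_field d_gt0 M_simplex Sb.
have yN : RT_N GN y.
  split=> // S' S'N x xS'; rewrite yE //; last exact: on_bdry S'N.
  by rewrite (_ : S' == S = false) //; apply/eqP => SS; rewrite -SS S'N in SN.
have := kkt1_green yN; rewrite yint addr0.
have pick (B : {set {set V}}) (F : {set V} -> R) : B \subset bdry_sides M ->
    \sum_(S' in B) vol S' * (F S' * ntrace y S' (bary S')) = vol S * ((S \in B)%:R * F S).
  move=> /fintype.subsetP BM; have E S' : S' \in B -> ntrace y S' (bary S') = (S' == S)%:R.
    by move=> /BM S'b; apply: yE => //; exact/bary_hull/(side_card_gt0 d_gt0)/bdry_side.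
  case: (boolP (S \in B)) => SB.
    rewrite (bigD1 S) //= E // eqxx mulr1 mul1r big1 ?addr0 // => S' /andP[S'B /negPf SS].
    by rewrite E // SS !mulr0.
  rewrite mul0r mulr0 big1 // => S' S'B; rewrite E // (_ : S' == S = false) ?mulr0 //.
  by apply/eqP => SS; rewrite -SS S'B in SB.
rewrite !pick ?sub_bdry ?fintype.subxx // Sb mul1r -mulrDr => /mulfI; apply.
by rewrite gt_eqF ?(side_vol_gt0 d_gt0 M_simplex) ?bdry_side.
Qed.

Let disjoint_notin (A B : {set {set V}}) S : A :&: B = finset.set0 -> S \in A ->
  (S \in B) = false.
Proof.
move=> AB SA; apply/negP => SB; move/finset.setP/(_ S): AB.
by rewrite finset.in_setI SA SB finset.in_set0.
Qed.

Lemma bdry_mean_I S : S \in sI -> bd u S = lm S (bary S) - lp S (bary S).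
Proof.
have [_ ID IN _] := M_resolves; move=> SI.
have SD := disjoint_notin ID SI; have SN := disjoint_notin IN SI.
have := @bdry_mean S; rewrite finset.in_setU SI SD SN => /(_ isT isT).
by rewrite mul1r mul0r => /eqP; rewrite addr_eq0 opprB => /eqP.
Qed.

Lemma bdry_mean_D S : S \in sD -> bd u S = uD S (bary S).
Proof.
have [_ ID _ DN] := M_resolves; move=> SD.
have SI : (S \in sI) = false by apply: disjoint_notin SD; rewrite finset.setIC.
have SN := disjoint_notin DN SD.
have := @bdry_mean S; rewrite finset.in_setU SI SD SN => /(_ isT isT).
by rewrite mul1r mul0r addr0.
Qed.

Hypothesis kkt2 : forall vbar : sfield M, pw_poly 0 vbar ->
  inner (elems M) (div_h z) vbar = - inner (elems M) f vbar.
Hypothesis kkt3 : m * mu + inner sI (fun S x => lp S x + lm S x) (fun _ _ => 1) = 0.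
Hypothesis feas : on_sides sI (fun S x =>
     0 <= mu + ntrace z S x /\ 0 <= mu - ntrace z S x).
Hypothesis cslack : on_sides sI (fun S x =>
     lp S x * (mu + ntrace z S x) = 0 /\ lm S x * (mu - ntrace z S x) = 0).
Hypothesis lam_le0 : on_sides sI (fun S x => lp S x <= 0 /\ lm S x <= 0).

Let grad_dist (w : sfield M) : R := \sum_(T in elems M)
  vol T * dot (grad_h w T 0 - grad_h u T 0) (grad_h w T 0 - grad_h u T 0).

(** The second KKT condition and the Neumann condition express f and g through z, and Green's
    formula turns these loads into the product of the gradients of w and [u] and terms on the other
    two boundary parts. *)
Lemma energyE (w : sfield M) : CR w ->
  2^-1 * vnorm2 (elems M) (grad_h w) ^+ 2
  + (2 * m)^-1 * norm1 sI (side_mean w) ^+ 2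
  - inner (elems M) f (Pi_h w) - inner sN g (side_mean w) =
  2^-1 * grad_dist w - 2^-1 * (\sum_(T in elems M) vol T * dot (grad_h u T 0) (grad_h u T 0))
  + (2 * m)^-1 * (\sum_(S in sI) vol S * `|bd w S|) ^+ 2
  + \sum_(S in sI) vol S * (bd w S * zn S) + \sum_(S in sD) vol S * (bd w S * zn S).
Proof.
move=> wCR; have [w1 _] := wCR.
have smE S x : S \in bdry_sides M -> side_mean w S x = bd w S.
  exact: (side_meanE d_gt0 M_simplex).
have -> : norm1 sI (side_mean w) = \sum_(S in sI) vol S * `|bd w S|.
  rewrite /norm1 mesh_int_const => [|S /on_bdry/bdry_side|S /on_bdry Sb x _].
  - by apply: eq_bigr => S /on_bdry Sb; rewrite smE.
  - exact: side_card_gt0.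
  - by rewrite !smE.
have -> : inner sN g (side_mean w) = \sum_(S in sN) vol S * (bd w S * zn S).
  rewrite (inner_sides d_gt0 (sub_sides _)).
  - apply: eq_bigr => S SN; rewrite smE ?(on_bdry SN) //.
    by rewrite /zn (z_N SN (bary_in SN)) [g _ _ * _]mulrC.
  - exact: (side_poly0 d_gt0 (sub_sides _) g_L0).
  - by move=> S /on_bdry Sb x _; rewrite !smE.
have := green_CR d_gt0 M_simplex M_conform wCR z_RT; rewrite sum_bdry_sides.
have -> : inner (elems M) (Pi_h w) (div_h z) = - inner (elems M) f (Pi_h w).
  rewrite -kkt2 => [|T TM]; last by apply/polynomial_fun0P; exists (mean T (w T)).
  apply: eq_bigr => T _; congr (int_simplex T _); apply/funext => x.
  exact: mulrC.
rewrite (vinner_grad_h M_simplex) // (vnorm2_grad_h M_simplex) //.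
(* Polarization, with the projection of z replaced by the gradient of [u]. *)
have -> : \sum_(T in elems M) vol T * dot (grad_h w T 0) (vPi_h z T 0) =
    2^-1 * (\sum_(T in elems M) vol T * dot (grad_h w T 0) (grad_h w T 0)
      + \sum_(T in elems M) vol T * dot (grad_h u T 0) (grad_h u T 0) - grad_dist w).
  rewrite -big_split -sumrB mulr_sumr; apply: eq_bigr => T TM /=.
  rewrite -(grad_h_reconstruction M_simplex 0 ubar_L0) // -/u.
  rewrite !(dotBr, dotBl) (dotC (grad_h u T 0) (grad_h w T 0)).
  by field.
lra.
Qed.

Lemma reconstruction_minimizer : discrete_primal_solution GI GD GN m f g uD u.
Proof.
split=> [|v vCR]; first exact: reconstruction_CR.
have uCR := reconstruction_CR; have [v1 _] := vCR.
rewrite /I_cr asboolT => [|S SD x xS]; last first.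
  rewrite (side_meanE d_gt0 M_simplex) ?(on_bdry SD) // -/(bd u S) bdry_mean_D //.
  by rewrite [RHS](side_poly0 d_gt0 (sub_sides _) uD_L0).
case: asboolP => [vD|_]; last exact: leey.
rewrite lee_fin !energyE //.
have -> : \sum_(S in sD) vol S * (bd v S * zn S) = \sum_(S in sD) vol S * (bd u S * zn S).
  apply: eq_bigr => S SD; rewrite bdry_mean_D // -(vD _ SD _ (bary_in SD)).
  by rewrite (side_meanE d_gt0 M_simplex) ?(on_bdry SD).
have -> : grad_dist u = 0.
  by rewrite /grad_dist big1 // => T _; rewrite subrr dot0l mulr0.
have gv0 : 0 <= grad_dist v.
  apply: sumr_ge0 => T TM.
  by rewrite mulr_ge0 ?dot_ge0 // ltW // (elem_vol_gt0 M_simplex).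
have volI S : S \in sI -> 0 <= vol S.
  by move=> SI; rewrite ltW // (side_vol_gt0 d_gt0 M_simplex) // bdry_side // (on_bdry SI).
have muE : m * mu = - \sum_(S in sI) vol S * (lp S (bary S) + lm S (bary S)).
  apply/eqP; rewrite -addr_eq0 -[X in _ == X]kkt3 (inner_sides d_gt0 (sub_sides _)) //.
    by apply/eqP; congr (_ + _); apply: eq_bigr => S _; rewrite mulr1.
  move=> S SI x xS; rewrite (side_poly0 d_gt0 (sub_sides _) lp_L0) //.
  by rewrite (side_poly0 d_gt0 (sub_sides _) lm_L0).
(* Both multipliers are nonpositive, so the modulus of their difference is at most minus their sum.
   An upper bound suffices, as the energy of [u] is to be bounded above. *)
have nu : \sum_(S in sI) vol S * `|bd u S| <= m * mu.
  rewrite muE -sumrN; apply: ler_sum => S SI; rewrite bdry_mean_I // -mulrN.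
  rewrite ler_wpM2l ?volI //; have [lp0 lm0] := lam_le0 SI (bary_in SI).
  by rewrite ler_norml; apply/andP; split; lra.
(* By complementarity, z . n acts as -mu on lambda^+ and as mu on lambda^-; the third KKT condition
   then sums mu (lambda^+ + lambda^-). *)
have uz : \sum_(S in sI) vol S * (bd u S * zn S) = - (m * mu ^+ 2).
  rewrite expr2 mulrA muE mulNr opprK mulr_suml; apply: eq_bigr => S SI.
  rewrite bdry_mean_I // -[RHS]mulrA; congr (_ * _).
  have [cp cm] := cslack SI (bary_in SI); rewrite -/(zn S) in cp cm.
  by move: cp cm; rewrite mulrDr mulrBr => cp cm; lra.
have vz : - (mu * \sum_(S in sI) vol S * `|bd v S|) <= \sum_(S in sI) vol S * (bd v S * zn S).
  rewrite mulr_sumr -sumrN; apply: ler_sum => S SI.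
  rewrite mulrCA -mulrN ler_wpM2l ?volI //.
  have [zp zm] := feas SI (bary_in SI); rewrite -/(zn S) in zp zm.
  have zmu : `|zn S| <= mu by rewrite ler_norml; apply/andP; split; lra.
  rewrite lerNl; apply: (le_trans (ler_norm _)); rewrite normrN normrM mulrC.
  by rewrite ler_wpM2r.
have nu0 : 0 <= \sum_(S in sI) vol S * `|bd u S|.
  by apply: sumr_ge0 => S SI; rewrite mulr_ge0 ?volI.
rewrite uz; move: nu nu0 vz gv0.
move: (\sum_(S in sI) vol S * `|bd u S|) (\sum_(S in sI) vol S * `|bd v S|) => n a nm n0 av gv0.
have n2 : n ^+ 2 <= (m * mu) ^+ 2 by rewrite lerXn2r ?nnegrE // (le_trans n0).
have i2 : 0 < (2 * m)^-1 by rewrite invr_gt0 mulr_gt0.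
(* Expanded, this square leaves (2 m)^-1 (m mu)^2 = m mu^2 / 2, half of the term [uz]; the other
   half absorbs the bound on (2 m)^-1 n^2. *)
have sq : 0 <= (2 * m)^-1 * (a - m * mu) ^+ 2 by rewrite mulr_ge0 ?sqr_ge0 // ltW.
have sqE : (2 * m)^-1 * (a - m * mu) ^+ 2 =
    (2 * m)^-1 * a ^+ 2 - mu * a + (2 * m)^-1 * (m * mu) ^+ 2.
  by field; rewrite gt_eqF.
have mmE : (2 * m)^-1 * (m * mu) ^+ 2 = 2^-1 * (m * mu ^+ 2).
  by field; rewrite gt_eqF.
have nn : (2 * m)^-1 * n ^+ 2 <= (2 * m)^-1 * (m * mu) ^+ 2 by rewrite ler_pM2l.
lra.
Qed.

End KKT.

Unset Implicit Arguments.

Theorem lemma7p1 (R : realType) (d : nat) (d_gt0 : (0 < d)%N)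
  (Omega GI GD GN : set 'rV[R]_d)
  (Omega_dom : bounded_lipschitz_domain Omega)
  (Gamma_split : boundary_splitting Omega GI GD GN)
  (GI_neq0 : GI !=set0)
  (M : mesh R d)
  (M_triang : triangulation M Omega)
  (M_resolves : resolves M GI GD GN)
  (m : R) (m_gt0 : 0 < m)
  (f g uD : sfield M)
  (f_L0 : pw_poly 0 f)
  (g_L0 : side_poly 0 (sides_on M GN) g)
  (uD_L0 : side_poly 0 (sides_on M GD) uD)
  (z : vfield M) (ubar : sfield M) (mu : R) (lp lm : sfield M)
  (z_RT : RT z)
  (ubar_L0 : pw_poly 0 ubar)
  (lp_L0 : side_poly 0 (sides_on M GI) lp)
  (lm_L0 : side_poly 0 (sides_on M GI) lm)
  (z_N : on_sides (sides_on M GN) (fun S x => ntrace z S x = g S x))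
  (kkt : forall (y : vfield M) (vbar : sfield M) (eta : R),
     RT_N GN y -> pw_poly 0 vbar ->
     [/\ vinner (elems M) (vPi_h z) (vPi_h y) + inner (elems M) ubar (div_h y)
         + inner (sides_on M GI) (fun S x => lp S x - lm S x) (ntrace y)
         = inner (sides_on M GD) uD (ntrace y),
         inner (elems M) (div_h z) vbar = - inner (elems M) f vbar &
         m * mu * eta
         + inner (sides_on M GI) (fun S x => lp S x + lm S x) (fun _ _ => eta)
         = 0])
  (feas : on_sides (sides_on M GI) (fun S x =>
     0 <= mu + ntrace z S x /\ 0 <= mu - ntrace z S x))
  (cslack : on_sides (sides_on M GI) (fun S x =>
     lp S x * (mu + ntrace z S x) = 0 /\ lm S x * (mu - ntrace z S x) = 0))
  (lam_le0 : on_sides (sides_on M GI) (fun S x => lp S x <= 0 /\ lm S x <= 0)) :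
  discrete_primal_solution GI GD GN m f g uD (reconstruction ubar z).
Proof.
have [M_simplex M_conform _] := M_triang.
(* The KKT conditions are quantified jointly over y, vbar and eta; zero fields fill the slots not
   under test, and eta = 1 gives the third condition. *)
have RTN0 : RT_N GN (fun (_ : {set vert M}) (_ : 'rV[R]_d) => 0 : 'rV[R]_d).
  by split=> [|S SN x xS]; [exact: RT0 | rewrite /ntrace dot0l].
have ub0 : pw_poly 0 (fun (_ : {set vert M}) (_ : 'rV[R]_d) => 0 : R).
  by move=> T TM; apply/polynomial_fun0P; exists 0.
apply: (reconstruction_minimizer d_gt0 M_simplex M_conform M_resolves m_gt0
  g_L0 uD_L0 z_RT ubar_L0 lp_L0 lm_L0 z_N (mu := mu)) => //.
- by move=> y yRT; have [] := kkt y _ 0 yRT ub0.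
- by move=> vbar vb0; have [] := kkt _ vbar 0 RTN0 vb0.
- by have [_ _] := kkt _ _ 1 RTN0 ub0; rewrite mulr1.
Qed.
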